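(* Let $\mathcal A$ be a unital $C^*$-algebra and let $H_{\mathcal A}$ be the standard Hilbert $\mathcal A$-module. For any bounded set $E\subset H_{\mathcal A}$ we have $\chi^*(E)=\lambda(E)$, where $\chi^*$ is the Hausdorff measure of noncompactness with respect to the family of seminorms defining Troitsky's topology on $H_{\mathcal A}$, and $\lambda(E)$ is the infimum of all $\eta>0$ for which there is a free finitely generated submodule $L\le H_{\mathcal A}$ with $\sup_{x\in E}\inf_{y\in L}\|x-y\|<\eta$.
   Context: $H_{\mathcal A}$ is the set of sequences $x=(\xi_1,\xi_2,\dots)$, $\xi_j\in\mathcal A$, such that $\sum_j\xi_j^*\xi_j$ converges in norm, with inner product $\langle x,y\rangle=\sum_j\xi_j^*\eta_j$ for $y=(\eta_1,\eta_2,\dots)$ and norm $\|x\|=\|\langle x,x\rangle\|^{1/2}$. Bounded means norm bounded. Troitsky's seminorms. A countable system $X=\{x_i\}_{i\ge1}\subset H_{\mathcal A}$ is called $H_{\mathcal A}$-admissible if (1) for every $x\in H_{\mathcal A}$ the series $\sum_i\langle x,x_i\rangle\langle x_i,x\rangle$ converges in norm; (2) its sum is $\le\langle x,x\rangle$; (3) $\|x_i\|\le1$ for all $i$. For an $H_{\mathcal A}$-admissible $X$ and a countable collection $\Phi=\{\varphi_1,\varphi_2,\dots\}$ of states on $\mathcal A$ put $$p_{X,\Phi}(x)=\sqrt{\sup_{k}\sum_{i=k}^{\infty}|\varphi_k(\langle x,x_i\rangle)|^2},\qquad x\in H_{\mathcal A}.$$ These are seminorms with $p_{X,\Phi}(x)\le\|x\|$;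 they define Troitsky's topology. Hausdorff measure. For bounded $E$ and a seminorm $p=p_{X,\Phi}$, $\chi_p(E)$ is the infimum of all $\varepsilon>0$ such that there are finitely many $y_1,\dots,y_m\in H_{\mathcal A}$ with $E\subseteq\bigcup_{j}\{x: p(x-y_j)<\varepsilon\}$; $\chi^*(E)=\sup_{X,\Phi}\chi_{p_{X,\Phi}}(E)$ over all $H_{\mathcal A}$-admissible $X$ and all countable collections $\Phi$ of states. In the definition of $\lambda$ the submodules $L$ are Hilbert (closed) submodules; free finitely generated means isomorphic to $\mathcal A^n$ for some $n$. *)

(* Defs.v *)
From HB Require Import structures.
From mathcomp Require Import all_boot all_order all_algebra.
From mathcomp Require Import complex.
From mathcomp Require Import all_classical all_reals all_analysis.

Set Implicit Arguments.
Unset Strict Implicit.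
Unset Printing Implicit Defensive.

Import Order.TTheory GRing.Theory Num.Theory.
Import numFieldNormedType.Exports.

Local Open Scope classical_set_scope.
Local Open Scope ring_scope.
Local Open Scope complex_scope.

(* Unital (nonzero) C*-algebras over the complex numbers R[i].  The algebra
   operations are fields of the mixin because the hierarchy has no join of
   normed modules and noncommutative rings: declaring a structure that inherits
   from both is rejected by Hierarchy Builder.  The norm of a normed module over
   R[i] is R[i]-valued. *)
HB.mixin Record isCStar (R : realType) A & CompleteNormedModule R[i] A := {
  cmul : A -> A -> A ;
  cone : A ;
  star : A -> A ;
  cmulA : associative cmul ;
  cmul1l : left_id cone cmul ;
  cmul1r : right_id cone cmul ;
  cmulDl : left_distributive cmul +%R ;
  cmulDr : right_distributive cmul +%R ;
  cmulZl : forall (c : R[i]) (a b : A), cmul (c *: a) b = c *: cmul a b ;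
  cmulZr : forall (c : R[i]) (a b : A), cmul a (c *: b) = c *: cmul a b ;
  cone_neq0 : cone != 0 ;
  starK : involutive star ;
  starD : {morph star : a b / a + b} ;
  starZ : forall (c : R[i]) (a : A), star (c *: a) = c^* *: star a ;
  starM : forall a b : A, star (cmul a b) = cmul (star b) (star a) ;
  cnormM : forall a b : A, `|cmul a b| <= `|a| * `|b| ;
  cnorm_star : forall a : A, `|cmul (star a) a| = `|a| ^+ 2
}.

#[short(type="cstarAlgType")]
HB.structure Definition CStarAlgebra (R : realType) :=
  {A of CompleteNormedModule R[i] A & isCStar R A}.

Notation "a ** b" := (cmul a b) (at level 40, left associativity) : ring_scope.

Definition rnorm {R : realType} {V : normedZmodType R[i]} (v : V) : R :=
  complex.Re `|v|.

Section CStar.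
Context {R : realType} {A : cstarAlgType R}.

Definition cstar_le (a b : A) : Prop := exists c : A, b - a = star c ** c.

Definition is_state (phi : {scalar A}) : Prop :=
  (forall a : A, 0 <= phi (star a ** a)) /\ phi cone = 1.

Definition ract (I : Type) (x : I -> A) (a : A) : I -> A := fun i => x i ** a.

End CStar.

Section StandardModule.
Context {R : realType} (A : cstarAlgType R).

(* The standard module is a set of sequences, closed under the pointwise
   addition and right multiplication of [nat -> A]. *)
Definition HA : set (nat -> A) :=
  [set x | cvgn (series (fun j => star (x j) ** x j))].

Definition hdot (x y : nat -> A) : A :=
  limn (series (fun j => star (x j) ** y j)).

Definition hnorm (x : nat -> A) : R := Num.sqrt (rnorm (hdot x x)).

Definition hbounded (E : set (nat -> A)) : Prop :=
  E `<=` HA /\ exists M : R, forall x, E x -> hnorm x <= M.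

(* Finite systems are covered by padding with zero vectors. *)
Definition admissible (X : nat -> nat -> A) : Prop :=
  [/\ forall i, HA (X i),
      forall x, HA x -> cvgn (series (fun i => hdot x (X i) ** hdot (X i) x)),
      forall x, HA x ->
        cstar_le (limn (series (fun i => hdot x (X i) ** hdot (X i) x)))
                 (hdot x x)
    & forall i, hnorm (X i) <= 1].

(* Finite collections of states are covered by repeating the last state, which
   does not change the supremum below. *)
Definition seminorm (X : nat -> nat -> A) (phi : nat -> {scalar A})
    (x : nat -> A) : \bar R :=
  sqrte (ereal_sup (range (fun k : nat =>
    (\sum_(k <= i <oo) (rnorm (phi k (hdot x (X i))) ^+ 2)%:E)%E))).

Definition hausdorff_mnc (p : (nat -> A) -> \bar R) (E : set (nat -> A))
    : \bar R :=
  ereal_inf [set eps%:E | eps in [set eps : R | 0 < eps /\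
    exists (m : nat) (y : 'I_m -> nat -> A), (forall j, HA (y j)) /\
      E `<=` \bigcup_j [set x | HA x /\ (p (x - y j)%R < eps%:E)%E]]].

Definition chi_star (E : set (nat -> A)) : \bar R :=
  ereal_sup [set r | exists (X : nat -> nat -> A) (phi : nat -> {scalar A}),
    [/\ admissible X, forall k, is_state (phi k)
      & r = hausdorff_mnc (seminorm X phi) E]].

Definition hilbert_submodule (L : set (nat -> A)) : Prop :=
  [/\ L `<=` HA, L 0, forall x y, L x -> L y -> L (x + y),
      forall x a, L x -> L (ract x a)
    & forall x, HA x ->
        (forall eps : R, 0 < eps -> exists2 y, L y & hnorm (x - y) < eps) ->
        L x].

Definition anorm (n : nat) (u : 'I_n -> A) : R :=
  Num.sqrt (rnorm (\sum_(i < n) star (u i) ** u i)).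

(* Isomorphism of Hilbert modules with A^n: a bijective A-linear map bounded in
   both directions.  C-linearity follows, A being unital. *)
Definition free_fg (L : set (nat -> A)) : Prop :=
  exists (n : nat) (T : ('I_n -> A) -> nat -> A),
    [/\ set_bij setT L T,
        forall u v, T (u + v) = T u + T v,
        forall u a, T (ract u a) = ract (T u) a,
        exists M : R, forall u, hnorm (T u) <= M * anorm u
      & exists M : R, forall u, anorm u <= M * hnorm (T u)].

Definition lambda_mnc (E : set (nat -> A)) : \bar R :=
  ereal_inf [set eta%:E | eta in [set eta : R | 0 < eta /\
    exists L : set (nat -> A), [/\ hilbert_submodule L, free_fg L
      & (ereal_sup [set ereal_inf [set (hnorm (x - y)%R)%:E | y in L]
                   | x in E] < eta%:E)%E]]].

End StandardModule.

(* Main.v *)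
From HB Require Import structures.
From mathcomp Require Import all_boot all_order all_algebra.
From mathcomp Require Import complex ring lra.
Require Import Defs.
From mathcomp Require Import all_classical all_reals all_analysis.

Set Implicit Arguments.
Unset Strict Implicit.
Unset Printing Implicit Defensive.

Import Order.TTheory GRing.Theory Num.Theory.
Import numFieldNormedType.Exports.

Local Open Scope classical_set_scope.
Local Open Scope ring_scope.
Local Open Scope complex_scope.

(** Each of the two measures bounds the other.

    chi* <= lambda. Let L be a free finitely generated submodule such that all
    points of E are at distance less than eta from L, let X = (x_i) be an
    admissible system and (phi_k) a sequence of states. The Cauchy-Schwarz
    inequality for states gives, for all k and n,
      sum_(k <= i < n) |phi_k <x, x_i>|^2 <= |sum_(k <= i < n) <x, x_i><x_i, x>|
                                          <= |x|^2
    (state_sum_window, window_le), so the seminorm is at most the norm, and it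
    remains to cover a bounded part of L by finitely many small balls for the
    seminorm (free_fg_totally_bounded). An element of L is a combination of
    finitely many generators g_l with bounded coordinates; since the series
    sum_i <g_l, x_i><x_i, g_l> converge in norm, the terms with i >= K
    contribute little, uniformly in k (window_tail_small). The finitely many
    scalars phi_k <y, x_i> with i, k < K are bounded, hence can be approximated
    by finitely many values (finite_net).

    lambda <= chi*. Let 0 < r < lambda(E). The first n coordinates span a free
    submodule, so for every n some point of E has a block of coordinates beyond
    n of norm greater than r (tail_of_lt_lambda). This produces points x_k of E
    and consecutive intervals of indices such that the block of x_k on the k-th
    interval has norm greater than r. The normalized blocks b_k are an
    admissible system, by the Bessel inequality (block_admissible). With phi_k a
    state that norms the inner square of the k-th block, |phi_k <x_k, b_k>| > r,
    whereas <y, b_k> tends to 0 for each fixed y (block_cvg0). Hence no finite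
    family of balls of radius less than r for this seminorm covers E
    (chi_star_ge).

    Both halves rest on the order of a C*-algebra: the elements star c ** c form
    a closed convex cone on which the norm is monotone (ispos_starM, isposD,
    ispos_cvg, ispos_rnorm_le), and each of them is normed by a state
    (norming_state). Positivity is developed without spectral theory: square
    roots come from a convergent iteration (sqrt_exists), and a self-adjoint h
    is a square exactly when |t - h| <= t for t at least |h| (isposP1, isposP2).
    States come from the Hahn-Banach theorem. *)

(** * Real-valued norms and convergence over the complex numbers *)

Section RealNorm.
Context {R : realType} {V : normedZmodType R[i]}.
Implicit Types (u v : V) (t : R).

(** The norm of a complex normed space is a nonnegative complex number; its real
    part carries all the information. *)
Lemma rnormE v : (rnorm v)%:C = `|v|.
Proof.
rewrite /rnorm [RHS]complexE (ger0_Im (normr_ge0 v)).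
by rewrite (_ : 0%:C = (0 : R[i])) ?mulr0 ?addr0.
Qed.

Lemma rnorm_ge0 v : 0 <= rnorm v.
Proof. by rewrite -lecR rnormE; exact: normr_ge0. Qed.
Hint Resolve rnorm_ge0 : core.

Lemma rnorm0 : rnorm (0 : V) = 0.
Proof. by rewrite /rnorm normr0. Qed.

Lemma rnorm_eq0 v : (rnorm v == 0) = (v == 0).
Proof. by rewrite -[RHS]normr_eq0 -rnormE; apply/eqP/eqP => [->//|[]]. Qed.

Lemma rnormN v : rnorm (- v) = rnorm v.
Proof. by rewrite /rnorm normrN. Qed.

Lemma rnormBC u v : rnorm (u - v) = rnorm (v - u).
Proof. by rewrite -rnormN opprB. Qed.

Lemma rnormD u v : rnorm (u + v) <= rnorm u + rnorm v.
Proof. by rewrite -lecR rmorphD /= !rnormE ler_normD. Qed.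

End RealNorm.
#[global] Hint Extern 0 (is_true (0 <= rnorm _)) => exact: rnorm_ge0 : core.

Section RealNormModule.
Context {R : realType} {V : normedModType R[i]}.
Implicit Types (u v : V) (t : R).

Lemma rnormZ t v : rnorm (t%:C *: v) = `|t| * rnorm v.
Proof.
by rewrite /rnorm normrZ -rnormE normc_def /= expr0n addr0 sqrtr_sqr /= mul0r subr0.
Qed.

Lemma cvg_rnormP (u : nat -> V) (l : V) :
  u @ \oo --> l <->
  forall e : R, 0 < e -> exists N, forall n, (N <= n)%N -> rnorm (u n - l) < e.
Proof.
split=> [/cvgrPdist_lt ul e e0|ul].
  have [|N _ hN] := ul e%:C; first by rewrite ltcR.
  by exists N => n /hN /=; rewrite -rnormE ltcR rnormBC.
apply/cvgrPdist_lt => -[e e'] he.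
have e'0 : e' = 0 by have := ger0_Im (ltW he).
move: he; rewrite e'0 => he.
have e0 : 0 < e by rewrite -ltcR.
have [N hN] := ul e e0.
by exists N => // n /= /hN; rewrite -rnormE rnormBC -ltcR.
Qed.

Lemma cvg_dominated (u : nat -> V) (l : V) (r : nat -> R) :
  (forall n, rnorm (u n - l) <= r n) -> r @ \oo --> (0 : R) -> u @ \oo --> l.
Proof.
move=> ur /cvgrPdist_lt r0; apply/cvg_rnormP => e /r0[N _ hN].
exists N => n /hN /=; rewrite sub0r normrN => h.
by rewrite (le_lt_trans (ur n))// (le_lt_trans _ h)// ler_norm.
Qed.

Lemma cvg_rnorm_dist (u : nat -> V) (l : V) :
  u @ \oo --> l -> (fun n => rnorm (u n - l)) @ \oo --> (0 : R).
Proof.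
move/cvg_rnormP => h; apply/cvgrPdist_lt => e /h[N hN].
by exists N => // n /= /hN; rewrite sub0r normrN ger0_norm.
Qed.

Lemma cvg_rnorm (u : nat -> V) (l : V) :
  u @ \oo --> l -> (fun n => rnorm (u n)) @ \oo --> rnorm l.
Proof.
move=> /cvg_rnormP h; apply/cvgrPdist_lt => e /h[N hN].
exists N => // n /= /hN; apply: le_lt_trans.
have h1 := rnormD (u n - l) l; have h2 := rnormD (l - u n) (u n).
rewrite !subrK rnormBC in h1 h2.
rewrite rnormBC ler_norml; lra.
Qed.

Lemma cvg_rnorm_le (u : nat -> V) (l : V) (M : R) :
  u @ \oo --> l -> (forall n, rnorm (u n) <= M) -> rnorm l <= M.
Proof.
move=> /cvg_rnorm h hM.
by apply: (cvgr_to_le h); near=> n.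
Unshelve. all: by end_near. Qed.

End RealNormModule.

Lemma complete_cauchy (R : realType) (V : completeNormedModType R[i])
    (u : nat -> V) :
  (forall e : R, 0 < e -> exists N, forall m n, (N <= m)%N -> (m <= n)%N ->
    rnorm (u n - u m) < e) -> cvgn u.
Proof.
move=> h; apply/cauchy_cvgP/cauchyP => -[e e'] he.
have e'0 : e' = 0 by have := ger0_Im (ltW he).
move: he; rewrite e'0 => he.
have e0 : 0 < e by rewrite -ltcR.
have [N hN] := h e e0.
exists (u N), N => // n /= hn; rewrite -ball_normE /=.
by rewrite -rnormE ltcR rnormBC hN.
Qed.

Lemma cvg_cauchy_rnorm (R : realType) (V : normedModType R[i]) (u : nat -> V) :
  cvgn u -> forall e : R, 0 < e ->
  exists N, forall m n, (N <= m)%N -> (N <= n)%N -> rnorm (u n - u m) < e.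
Proof.
move=> /cvg_ex[l /cvg_rnormP h] e e0.
have [N hN] := h (e / 2) ltac:(by rewrite divr_gt0).
exists N => m n /hN hm /hN hn.
rewrite -[u n](subrK l) -addrA (le_lt_trans (rnormD _ _))//.
rewrite (rnormBC l); lra.
Qed.
(** * Identities between linear combinations *)

(** The square-zero extension of a ring by a module: it is a commutative ring
    that contains the module as an ideal, so that the [ring] tactic decides
    identities between linear combinations. *)
Definition sqz_ext (K : comNzRingType) (V : lmodType K) : Type := (K * V)%type.

Section SquareZero.
Context {K : comNzRingType} {V : lmodType K}.
Local Notation T := (sqz_ext V).
Implicit Types p q r : T.

HB.instance Definition _ := GRing.Zmodule.copy T (K * V)%type.

(** Unit and product of the extension: (a, u) (b, v) = (a b, a v + b u). *)
Definition sqz_one : T := (1, 0).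
Definition sqz_mul p q : T := (p.1 * q.1, p.1 *: q.2 + q.1 *: p.2).

Lemma sqz_mulA : associative sqz_mul.
Proof.
move=> [a u] [b v] [c w]; rewrite /sqz_mul /= mulrA !scalerDr !scalerA addrA.
by rewrite (mulrC b c) (mulrC a c).
Qed.

Lemma sqz_mulC : commutative sqz_mul.
Proof. by move=> [a u] [b v]; rewrite /sqz_mul /= mulrC addrC. Qed.

Lemma sqz_mul1 : left_id sqz_one sqz_mul.
Proof. by move=> [a u]; rewrite /sqz_mul /= mul1r scale1r scaler0 addr0. Qed.

Lemma sqz_mulD : left_distributive sqz_mul +%R.
Proof.
move=> [a u] [b v] [c w]; rewrite /sqz_mul /= mulrDl scalerDl scalerDr.
by rewrite addrACA.
Qed.

Lemma sqz_1_neq0 : sqz_one != 0.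
Proof. by apply/eqP => -[] /eqP; rewrite oner_eq0. Qed.

HB.instance Definition _ := GRing.Zmodule_isComNzRing.Build T
  sqz_mulA sqz_mulC sqz_mul1 sqz_mulD sqz_1_neq0.

(** The embeddings of the module and of the scalars. *)
Definition sqz_in (u : V) : T := (0, u).
Definition sqz_scal (a : K) : T := (a, 0).

Lemma sqz_scal_additive : additive sqz_scal.
Proof. by move=> a b; rewrite /sqz_scal; congr (_, _); rewrite /= subr0. Qed.

Lemma sqz_scal_multiplicative : multiplicative sqz_scal.
Proof.
by split=> // a b; congr (_, _); rewrite /= !scaler0 addr0.
Qed.

HB.instance Definition _ :=
  GRing.isAdditive.Build K T sqz_scal sqz_scal_additive.
HB.instance Definition _ :=
  GRing.isMultiplicative.Build K T sqz_scal sqz_scal_multiplicative.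

Lemma sqz_in_inj : injective sqz_in.
Proof. by move=> u v []. Qed.

Lemma sqz_inD u v : sqz_in (u + v) = sqz_in u + sqz_in v.
Proof. by congr (_, _); rewrite /= addr0. Qed.

Lemma sqz_inN u : sqz_in (- u) = - sqz_in u.
Proof. by congr (_, _); rewrite /= oppr0. Qed.

Lemma sqz_in0 : sqz_in 0 = 0.
Proof. by []. Qed.

Lemma sqz_inZ a u : sqz_in (a *: u) = sqz_scal a * sqz_in u.
Proof. by congr (_, _); rewrite /= ?mulr0 ?scale0r ?addr0. Qed.

End SquareZero.

(** Decides identities between linear combinations in a module over a
    commutative ring. *)
Ltac module := apply: sqz_in_inj;
  rewrite ?(sqz_inD, sqz_inN, sqz_inZ, sqz_in0); ring.

(** * Algebra of a C*-algebra and square roots near the unit *)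

Section Algebra.
Context {R : realType} {A : cstarAlgType R}.
Implicit Types (a b c d h s x : A) (t : R).

Lemma cmul0l a : 0 ** a = 0.
Proof. by rewrite -[X in X ** a](scale0r (0 : A)) cmulZl scale0r. Qed.

Lemma cmul0r a : a ** 0 = 0.
Proof. by rewrite -[X in a ** X](scale0r (0 : A)) cmulZr scale0r. Qed.

Lemma cmulNl a b : (- a) ** b = - (a ** b).
Proof. by rewrite -scaleN1r cmulZl scaleN1r. Qed.

Lemma cmulNr a b : a ** (- b) = - (a ** b).
Proof. by rewrite -scaleN1r cmulZr scaleN1r. Qed.

Lemma cmulBl a b c : (a - b) ** c = a ** c - b ** c.
Proof. by rewrite cmulDl cmulNl. Qed.

Lemma cmulBr a b c : c ** (a - b) = c ** a - c ** b.
Proof. by rewrite cmulDr cmulNr. Qed.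

Lemma cmul_suml (I : Type) (r : seq I) (P : pred I) (F : I -> A) a :
  (\sum_(i <- r | P i) F i) ** a = \sum_(i <- r | P i) F i ** a.
Proof.
by apply: (big_morph (fun x => x ** a)) => [x y|]; rewrite ?cmulDl ?cmul0l.
Qed.

(** Distributes products over linear combinations. *)
Definition cmulE :=
  (@cmulDl R A, @cmulDr R A, cmulNl, cmulNr, @cmulZl R A, @cmulZr R A,
   @cmul1l R A, @cmul1r R A).

Lemma star0 : star 0 = 0 :> A.
Proof. by apply: (addrI (star 0)); rewrite -starD !addr0. Qed.

Lemma starN a : star (- a) = - star a.
Proof. by apply/eqP; rewrite -addr_eq0 -starD addNr star0. Qed.

Lemma starB a b : star (a - b) = star a - star b.
Proof. by rewrite starD starN. Qed.

Lemma star_sum (I : Type) (r : seq I) (P : pred I) (F : I -> A) :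
  star (\sum_(i <- r | P i) F i) = \sum_(i <- r | P i) star (F i).
Proof. by apply: (big_morph star) => [x y|]; rewrite ?starD ?star0. Qed.

Lemma star1 : star cone = cone :> A.
Proof. by rewrite -[LHS]cmul1l -{1}[cone]starK -starM cmul1l starK. Qed.

Lemma starZr t a : star (t%:C *: a) = t%:C *: star a.
Proof. by rewrite starZ; congr (_ *: _); exact: conjc_real. Qed.

Lemma starZi a : star ('i%C *: a) = - ('i%C *: star a).
Proof.
rewrite starZ -scaleNr; congr (_ *: _).
by apply/eqP; rewrite eq_complex /= oppr0 !eqxx.
Qed.

Lemma rnormM a b : rnorm (a ** b) <= rnorm a * rnorm b.
Proof. by rewrite -lecR rmorphM /= !rnormE cnormM. Qed.

Lemma rnorm_starM a : rnorm (star a ** a) = rnorm a ^+ 2.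
Proof.
have : (rnorm (star a ** a))%:C = (rnorm a ^+ 2)%:C.
  by rewrite rmorphXn /= !rnormE cnorm_star.
by case.
Qed.

Lemma rnorm_star a : rnorm (star a) = rnorm a.
Proof.
suff h b : rnorm b <= rnorm (star b).
  by apply/eqP; rewrite eq_le h -{1}[a in X in _ <= X]starK h.
have [b0|b0] := eqVneq (rnorm b) 0; first by rewrite b0.
have := rnormM (star b) b; rewrite rnorm_starM expr2 ler_pM2r//.
by rewrite lt_def b0 rnorm_ge0.
Qed.

Lemma rnorm1 : rnorm (cone : A) = 1.
Proof.
have := rnorm_starM cone; rewrite star1 cmul1l.
have : rnorm (cone : A) != 0 by rewrite rnorm_eq0 cone_neq0.
by move=> n0 /eqP; rewrite expr2 -{1}[rnorm _]mulr1 => /eqP/(mulfI n0).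
Qed.

Lemma rnormZ1 t : rnorm (t%:C *: cone : A) = `|t|.
Proof. by rewrite rnormZ rnorm1 mulr1. Qed.

Lemma cvg_cmul (u v : nat -> A) a b : u @ \oo --> a -> v @ \oo --> b ->
  (fun n => u n ** v n) @ \oo --> a ** b.
Proof.
move=> ua vb.
apply: (@cvg_dominated _ _ _ _ (fun n =>
  rnorm (u n - a) * rnorm (v n) + rnorm a * rnorm (v n - b))).
  move=> n; rewrite (_ : _ - _ = (u n - a) ** v n + a ** (v n - b)).
    by rewrite (le_trans (rnormD _ _))// lerD// rnormM.
  by rewrite cmulBl cmulBr addrA subrK.
rewrite -[0](_ : 0 * rnorm b + rnorm a * 0 = 0); last by rewrite mul0r mulr0 addr0.
apply: cvgD; apply: cvgM.
- exact: cvg_rnorm_dist.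
- exact: cvg_rnorm.
- exact: cvg_cst.
- exact: cvg_rnorm_dist.
Qed.

Lemma cvg_star (u : nat -> A) a : u @ \oo --> a ->
  (fun n => star (u n)) @ \oo --> star a.
Proof.
move=> ua; apply: (@cvg_dominated _ _ _ _ (fun n => rnorm (u n - a))).
  by move=> n; rewrite -starB rnorm_star.
exact: cvg_rnorm_dist.
Qed.

(** Self-adjoint elements. *)
Definition selfadj a := star a = a.

Lemma selfadj0 : selfadj 0. Proof. exact: star0. Qed.
Lemma selfadj1 : selfadj cone. Proof. exact: star1. Qed.

Lemma selfadjD a b : selfadj a -> selfadj b -> selfadj (a + b).
Proof. by rewrite /selfadj starD => -> ->. Qed.

Lemma selfadjB a b : selfadj a -> selfadj b -> selfadj (a - b).
Proof. by rewrite /selfadj starB => -> ->. Qed.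

Lemma selfadjZ t a : selfadj a -> selfadj (t%:C *: a).
Proof. by rewrite /selfadj starZr => ->. Qed.

Lemma selfadjM a b : selfadj a -> selfadj b -> a ** b = b ** a ->
  selfadj (a ** b).
Proof. by rewrite /selfadj starM => -> -> ->. Qed.

Lemma selfadj_starM a : selfadj (star a ** a).
Proof. by rewrite /selfadj starM starK. Qed.

Lemma rnorm_sq s : selfadj s -> rnorm (s ** s) = rnorm s ^+ 2.
Proof. by move=> ss; rewrite -rnorm_starM ss. Qed.

Lemma cvg_unique_rnorm (u : nat -> A) a b :
  u @ \oo --> a -> u @ \oo --> b -> a = b.
Proof. by move=> ua ub; exact: (cvg_unique _ ua ub). Qed.

Lemma cvg_selfadj (u : nat -> A) a : (forall n, selfadj (u n)) ->
  u @ \oo --> a -> selfadj a.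
Proof.
move=> su ua; apply: (cvg_unique_rnorm (cvg_star ua)).
by under eq_fun do rewrite su.
Qed.

Lemma cvg_comm (u : nat -> A) a c : (forall n, c ** u n = u n ** c) ->
  u @ \oo --> a -> c ** a = a ** c.
Proof.
move=> cu ua; apply: (@cvg_unique_rnorm (fun n => c ** u n)).
  by apply: cvg_cmul ua; exact: cvg_cst.
by under eq_fun do rewrite cu; apply: cvg_cmul ua _; exact: cvg_cst.
Qed.

(** The square root of 1 - d is 1 - x, where x solves x = (d + x^2) / 2 and is
    the limit of the iteration from 0. *)
Fixpoint sqrt_iter d n : A :=
  if n is m.+1 then (2^-1)%:C *: (d + sqrt_iter d m ** sqrt_iter d m) else 0.

(** The same iteration for the number 1: it increases, is bounded by 1, and
    majorizes the iteration for every d of norm at most 1, also when the norm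
    of d is 1 and the iteration is not a contraction. *)
Fixpoint sqrt_maj n : R :=
  if n is m.+1 then 2^-1 * (1 + sqrt_maj m ^+ 2) else 0.

Lemma sqrt_maj_itv n : 0 <= sqrt_maj n <= 1.
Proof.
elim: n => [|n /andP[n0 n1]] /=; first by rewrite lexx ler01.
have := sqr_ge0 (sqrt_maj n); have := exprn_ile1 2 n0 n1 => h1 h2.
by apply/andP; split; lra.
Qed.

Lemma sqrt_maj_homo : {homo sqrt_maj : m n / (m <= n)%N >-> m <= n}.
Proof.
apply: homo_leq => [//|y x z|n]; first exact: le_trans.
elim: n => [|n IH]; first by rewrite /=; lra.
have /andP[n0 n1] := sqrt_maj_itv n; have /andP[m0 m1] := sqrt_maj_itv n.+1.
rewrite -[leLHS]/(2^-1 * (1 + sqrt_maj n ^+ 2)).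
rewrite -[leRHS]/(2^-1 * (1 + sqrt_maj n.+1 ^+ 2)).
by rewrite ler_pM2l ?invr_gt0// lerD2l lerXn2r.
Qed.

Lemma sqrt_iter_le d n : rnorm d <= 1 -> rnorm (sqrt_iter d n) <= sqrt_maj n.
Proof.
move=> d1; elim: n => [|n IH] /=; first by rewrite rnorm0.
rewrite rnormZ ger0_norm ?invr_ge0// ler_pM2l ?invr_gt0//.
rewrite (le_trans (rnormD _ _))// lerD// (le_trans (rnormM _ _))//.
by rewrite expr2 ler_pM.
Qed.

Lemma sqrt_iter_step d n : rnorm d <= 1 ->
  rnorm (sqrt_iter d n.+1 - sqrt_iter d n) <= sqrt_maj n.+1 - sqrt_maj n.
Proof.
move=> d1; elim: n => [|n IH].
  rewrite /= cmul0l expr0n addr0 !subr0 addr0 rnormZ ger0_norm//.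
  by rewrite ler_pM2l.
set x := sqrt_iter d n.+1 in IH *; set y := sqrt_iter d n in IH *.
set p := sqrt_maj n.+1 in IH *; set q := sqrt_maj n in IH *.
have xp : rnorm x <= p by exact: sqrt_iter_le.
have yq : rnorm y <= q by exact: sqrt_iter_le.
have -> : sqrt_iter d n.+2 - x = (2^-1)%:C *: (x ** (x - y) + (x - y) ** y).
  rewrite [sqrt_iter _ _]/= -/x -/y {2}/x [sqrt_iter _ _]/= -/y -scalerBr.
  by rewrite opprD addrACA subrr add0r cmulBr cmulBl addrA subrK.
have -> : sqrt_maj n.+2 - p = 2^-1 * (p * (p - q) + (p - q) * q).
  have pE : p = 2^-1 * (1 + q ^+ 2) by [].
  by rewrite -[sqrt_maj n.+2]/(2^-1 * (1 + p ^+ 2)) [in X in _ - X]pE; field.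
rewrite rnormZ ger0_norm// ler_pM2l// (le_trans (rnormD _ _))// lerD//.
  by rewrite (le_trans (rnormM _ _))// ler_pM.
by rewrite (le_trans (rnormM _ _))// ler_pM.
Qed.

Lemma sqrt_iter_dist d m n : rnorm d <= 1 -> (m <= n)%N ->
  rnorm (sqrt_iter d n - sqrt_iter d m) <= sqrt_maj n - sqrt_maj m.
Proof.
move=> d1 /subnKC <-; elim: (n - m)%N => [|k IH].
  by rewrite addn0 !subrr rnorm0.
rewrite addnS -(subrK (sqrt_iter d (m + k)) (sqrt_iter d _.+1)) -addrA.
rewrite (le_trans (rnormD _ _))//.
by have := sqrt_iter_step (m + k) d1; move: IH; lra.
Qed.

Lemma sqrt_iter_cvg d : rnorm d <= 1 -> cvgn (sqrt_iter d).
Proof.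
move=> d1; have : cvgn sqrt_maj.
  apply: nondecreasing_is_cvgn; first exact: sqrt_maj_homo.
  by exists 1 => _ [n _ <-]; have /andP[] := sqrt_maj_itv n.
move=> /cvg_ex[l /cvgrPdist_lt maj_l]; apply: complete_cauchy => e e0.
have [|N _ hN] := maj_l (e / 2); first by rewrite divr_gt0.
exists N => m n Nm mn.
rewrite (le_lt_trans (sqrt_iter_dist d1 mn))//.
have := hN _ Nm; have := hN _ (leq_trans Nm mn); rewrite /= !ltr_norml.
by move=> /andP[h1 h2] /andP[h3 h4]; lra.
Qed.

(** The commutation clause lets square roots of commuting elements be chosen to
    commute. *)
Lemma sqrt_exists d : selfadj d -> rnorm d <= 1 ->
  exists u, [/\ selfadj u, rnorm (cone - u) <= 1, u ** u = cone - d
    & forall c, c ** d = d ** c -> c ** u = u ** c].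
Proof.
move=> sd d1; have /cvg_ex[x dx] := sqrt_iter_cvg d1.
have xx : x + x = d + x ** x.
  have h : (2^-1)%:C *: (d + x ** x) = x.
    apply: (@cvg_unique_rnorm (fun n => sqrt_iter d n.+1)) => /=.
      apply: cvgZ; first exact: cvg_cst.
      by apply: cvgD; [exact: cvg_cst|exact: cvg_cmul].
    by rewrite (cvg_shiftS (sqrt_iter d)).
  rewrite -{1 2}h -scalerDl -rmorphD /= (_ : _ + _ = 1); last lra.
  by rewrite scale1r.
exists (cone - x); split.
- apply: selfadjB; first exact: selfadj1.
  apply: cvg_selfadj dx => n; elim: n => [|n IH]/=; first exact: selfadj0.
  by apply/selfadjZ/selfadjD => //; exact: selfadjM.
- rewrite opprB addrCA subrr addr0; apply: cvg_rnorm_le dx _ => n.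
  rewrite (le_trans (sqrt_iter_le n d1))//.
  by have /andP[] := sqrt_maj_itv n.
- rewrite cmulBl cmul1l cmulBr cmul1r -addrA; congr (_ + _).
  by rewrite opprB addrCA -opprD xx opprD addrCA subrr addr0.
- move=> c cd; rewrite cmulBl cmulBr cmul1l cmul1r; congr (_ - _).
  apply: cvg_comm dx => n; elim: n => [|n IH]/=; first by rewrite cmul0l cmul0r.
  by rewrite cmulZl cmulZr cmulDl cmulDr cd cmulA IH -!cmulA IH.
Qed.

End Algebra.

(** * The cone of positive elements *)

Section Positivity.
Context {R : realType} {A : cstarAlgType R}.
Implicit Types (a b c h k s x y : A) (t : R).

(* Real multiples of the unit. *)
Local Notation sc t := (t%:C *: (cone : A)).

(** Positive elements, encoded as squares of self-adjoint elements; the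
    elements star c ** c are shown below to be the same ones. *)
Definition ispos h := exists2 s, selfadj s & h = s ** s.

Lemma scD t t' : sc (t + t') = sc t + sc t'.
Proof. by rewrite rmorphD /= scalerDl. Qed.

Lemma selfadj_sc t : selfadj (sc t).
Proof. exact/selfadjZ/selfadj1. Qed.

Lemma cmul_scl t a : sc t ** a = t%:C *: a.
Proof. by rewrite cmulZl cmul1l. Qed.

Lemma cmul_scr t a : a ** sc t = t%:C *: a.
Proof. by rewrite cmulZr cmul1r. Qed.

Lemma ispos_selfadj h : ispos h -> selfadj h.
Proof. by case=> s ss ->; exact: selfadjM. Qed.

Lemma ispos0 : ispos 0.
Proof. by exists 0; rewrite ?cmul0l//; exact: selfadj0. Qed.

(** A self-adjoint element within distance t of t times the unit has a square
    root with the same property for the square root of t. *)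
Lemma ispos_sqr_root h t : selfadj h -> rnorm (sc t - h) <= t ->
  exists s, [/\ selfadj s, h = s ** s, rnorm (sc (Num.sqrt t) - s) <= Num.sqrt t
    & forall c, c ** h = h ** c -> c ** s = s ** c].
Proof.
move=> sh ht; have := le_trans (rnorm_ge0 _) ht.
rewrite le_eqVlt => /orP[/eqP t0|t0].
  move: ht; rewrite -t0 scale0r sub0r rnormN => h0.
  have {}h0 : h = 0 by apply/eqP; rewrite -rnorm_eq0 eq_le h0 rnorm_ge0.
  exists 0; rewrite h0 sqrtr0 scale0r subr0 rnorm0 cmul0l; split => //.
  exact: selfadj0.
have [||u [su u1 uu uc]] := @sqrt_exists R A (cone - (t^-1)%:C *: h).
- by apply: selfadjB; [exact: selfadj1|exact: selfadjZ].
- have -> : cone - (t^-1)%:C *: h = (t^-1)%:C *: (sc t - h).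
    by rewrite scalerBr scalerA -rmorphM /= mulVf ?gt_eqF// scale1r.
  by rewrite rnormZ gtr0_norm ?invr_gt0// ler_pdivrMl// mulr1.
exists ((Num.sqrt t)%:C *: u); split.
- exact: selfadjZ.
- rewrite cmulZl cmulZr scalerA -rmorphM /= -expr2 sqr_sqrtr ?(ltW t0)// uu.
  by rewrite opprB addrC subrK scalerA -rmorphM /= mulfV ?gt_eqF// scale1r.
- rewrite -scalerBr rnormZ ger0_norm ?sqrtr_ge0//.
  by rewrite ler_piMr ?sqrtr_ge0.
- move=> c ch; rewrite cmulZl cmulZr uc// cmulBl cmulBr cmul1l cmul1r.
  by rewrite cmulZl cmulZr ch.
Qed.

Lemma isposP1 h t : selfadj h -> rnorm (sc t - h) <= t -> ispos h.
Proof. by move=> sh /(ispos_sqr_root sh)[s [ss hs _ _]]; exists s. Qed.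

(** If x and y commute and x^2 + y^2 = t, then b = x + i y satisfies
    star b ** b = t, so the norm of its real part x is at most that of b. *)
Lemma rnorm_circle x y t : selfadj x -> selfadj y -> x ** y = y ** x ->
  0 <= t -> x ** x + y ** y = sc t -> rnorm x ^+ 2 <= t.
Proof.
move=> sx sy xy t0 xyt; pose b := x + 'i%C *: y.
have sb : star b = x - 'i%C *: y.
  by rewrite starD starZi sx sy.
have bt : rnorm b ^+ 2 = t.
  rewrite -rnorm_starM sb /b cmulBl !cmulDr !cmulZl !cmulZr.
  rewrite -xy opprD addrA addrK scalerA -expr2 sqr_i scaleN1r opprK.
  by rewrite xyt rnormZ1 ger0_norm.
have : rnorm (x + x) <= rnorm b + rnorm b.
  rewrite -[in X in _ <= _ + X](rnorm_star b).
  suff -> : x + x = b + star b by exact: rnormD.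
  by rewrite sb addrACA subrr addr0.
have -> : x + x = (2 : R)%:C *: x.
  by rewrite (_ : 2 = 1 + 1)// rmorphD /= scalerDl scale1r.
rewrite rnormZ ger0_norm// -bt => h.
by rewrite lerXn2r ?nnegrE//; lra.
Qed.

(** With isposP1, this characterizes positivity of a self-adjoint h by the norm
    inequality |t - h| <= t, for any t at least the norm of h; this makes the
    positive elements a closed convex cone. *)
Lemma isposP2 h t : ispos h -> rnorm h <= t -> rnorm (sc t - h) <= t.
Proof.
case=> s ss ->; rewrite rnorm_sq// => st.
have := le_trans (sqr_ge0 _) st; rewrite le_eqVlt => /orP[/eqP t0|t0].
  by rewrite -t0 scale0r sub0r rnormN rnorm_sq// t0.
pose r := Num.sqrt t.
have r0 : 0 < r by rewrite sqrtr_gt0.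
have rt : r ^+ 2 = t by rewrite sqr_sqrtr// ltW.
pose x := (r^-1)%:C *: s.
have sx : selfadj x by exact: selfadjZ.
have xr : rnorm (x ** x) <= 1.
  rewrite rnorm_sq// rnormZ gtr0_norm ?invr_gt0// exprMn exprVn rt.
  by rewrite ler_pdivrMl// mulr1.
have [u [su u1 uu uc]] := sqrt_exists (selfadjM sx sx erefl) xr.
have cxu : u ** x = x ** u by rewrite uc// cmulA.
have u21 : rnorm u ^+ 2 <= 1.
  apply: (rnorm_circle su sx cxu ler01).
  by rewrite uu subrK scale1r.
have -> : sc t - s ** s = t%:C *: (u ** u).
  rewrite uu scalerBr /x cmulZl cmulZr !scalerA -!rmorphM /=.
  by rewrite -invfM -expr2 rt mulfV ?gt_eqF// scale1r.
by rewrite rnormZ rnorm_sq// gtr0_norm// ler_piMr// ltW.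
Qed.

Lemma ispos_root h : ispos h ->
  exists s, [/\ ispos s, h = s ** s
    & forall c, c ** h = h ** c -> c ** s = s ** c].
Proof.
move=> hp; have sh := ispos_selfadj hp.
have [s [ss hs sr sc]] := ispos_sqr_root sh (isposP2 hp (lexx _)).
by exists s; split => //; exact: isposP1 sr.
Qed.

Lemma isposD h k : ispos h -> ispos k -> ispos (h + k).
Proof.
move=> hp kp; apply: (@isposP1 _ (rnorm h + rnorm k)).
  by apply: selfadjD; exact: ispos_selfadj.
rewrite scD opprD addrACA (le_trans (rnormD _ _))//.
by rewrite lerD// isposP2.
Qed.

Lemma isposZ h t : 0 <= t -> ispos h -> ispos (t%:C *: h).
Proof.
move=> t0 [s ss ->]; exists ((Num.sqrt t)%:C *: s); first exact: selfadjZ.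
by rewrite cmulZl cmulZr scalerA -rmorphM /= -expr2 sqr_sqrtr.
Qed.

Lemma ispos_sum (I : Type) (r : seq I) (P : pred I) (F : I -> A) :
  (forall i, P i -> ispos (F i)) -> ispos (\sum_(i <- r | P i) F i).
Proof. by move=> h; elim/big_ind : _ => //; [exact: ispos0|exact: isposD]. Qed.

Lemma ispos_sc t : 0 <= t -> ispos (sc t).
Proof.
by move=> t0; apply: isposZ => //; exists cone; rewrite ?cmul1l//; exact: selfadj1.
Qed.

Lemma ispos_rnormB h : selfadj h -> ispos (sc (rnorm h) - h).
Proof.
move=> sh; apply: (@isposP1 _ (rnorm h)).
  by apply: selfadjB => //; exact: selfadj_sc.
by rewrite opprB addrC subrK.
Qed.

Lemma ispos_cvg (u : nat -> A) h : (forall n, ispos (u n)) ->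
  u @ \oo --> h -> ispos h.
Proof.
move=> up uh; have sh : selfadj h.
  by apply: cvg_selfadj uh => n; exact: ispos_selfadj.
apply: (@isposP1 _ (rnorm h + 1)) => //; apply/ler_addgt0Pr => e e0.
have [|N hN] := (cvg_rnormP _ _).1 uh (Num.min e 1).
  by rewrite lt_min e0 ltr01.
have := hN _ (leqnn N); rewrite lt_min => /andP[ue u1].
rewrite -(subrK (u N) (sc _)) -addrA (le_trans (rnormD _ _))//.
rewrite lerD// ?(ltW ue)// isposP2// -(subrK h (u N)) addrC.
by rewrite (le_trans (rnormD _ _))// lerD// ltW.
Qed.

(** Take commuting square roots s of x and r of t - x; then w = x - t / 2
    satisfies w^2 + (s r)^2 = (t / 2)^2. *)
Lemma ispos_rnorm_le_sc x t : 0 <= t -> ispos x -> ispos (sc t - x) ->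
  rnorm x <= t.
Proof.
move=> t0 xp yp; have sx := ispos_selfadj xp.
have [s [/ispos_selfadj ss xs cs]] := ispos_root xp.
have [r [/ispos_selfadj sr yr cr]] := ispos_root yp.
have cxs : s ** x = x ** s by rewrite xs cmulA.
have crs : s ** r = r ** s.
  by apply: cr; rewrite cmulBl cmulBr cmul_scl cmul_scr cxs.
have cxr : x ** r = r ** x by apply: cr; rewrite !cmulE.
pose w := x - sc (t / 2).
have sw : selfadj w by apply: selfadjB => //; exact: selfadj_sc.
have : rnorm w ^+ 2 <= (t / 2) ^+ 2.
  apply: (@rnorm_circle w (s ** r)) => //.
  - exact: selfadjM.
  - rewrite /w !cmulE; congr (_ - _).
    by rewrite cmulA -cxs -!cmulA cxr.
  - exact: sqr_ge0.
  have -> : s ** r ** (s ** r) = x ** (sc t - x).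
    by rewrite yr xs -!cmulA; congr (_ ** _); rewrite !cmulA crs.
  have tE : t = t / 2 + t / 2 by field.
  by rewrite /w; move: (t / 2) tE => r' ->; rewrite !cmulE; module.
rewrite ler_pXn2r ?nnegrE// ?divr_ge0// => wt.
have -> : x = w + sc (t / 2) by rewrite subrK.
rewrite (le_trans (rnormD _ _))// rnormZ1 ger0_norm ?divr_ge0//; lra.
Qed.

Lemma ispos_rnorm_le x y : ispos x -> ispos (y - x) -> rnorm x <= rnorm y.
Proof.
move=> xp yxp; apply: ispos_rnorm_le_sc => //.
have yp : ispos y by rewrite -(subrK x y); exact: isposD.
rewrite -(subrK y (sc _)) -addrA; apply: isposD => //.
exact/ispos_rnormB/ispos_selfadj.
Qed.

(** Writing b in terms of the self-adjoint x = b + star b and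
    y = i (b - star b), the sum of squares x^2 + y^2 is twice
    b ** star b + star b ** b. *)
Lemma ispos_mul_star b k : star b ** b = - k -> ispos k -> ispos (b ** star b).
Proof.
move=> bk kp.
pose x := b + star b; pose y := 'i%C *: (b - star b).
have sx : selfadj x by rewrite /selfadj starD starK addrC.
have sy : selfadj y.
  by rewrite /selfadj starZi starB starK -scalerN opprB.
have E : x ** x + y ** y = (2 : R)%:C *: (b ** star b) - (2 : R)%:C *: k.
  rewrite /x /y cmulZl cmulZr scalerA -expr2 sqr_i scaleN1r !cmulE bk.
  by module.
have -> : b ** star b = (2^-1 : R)%:C *: (x ** x + y ** y) + k.
  rewrite E scalerBr !scalerA -!rmorphM /= mulVf// !scale1r subrK//.
apply: isposD => //; apply: isposZ; first by rewrite invr_ge0.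
by apply: isposD; [exists x|exists y].
Qed.

(** Since q = b ** star b is positive of norm at most 1, multiplication by 1 - q
    does not increase the norm of b; but (1 - q) b is z := b (1 + k), and star z ** z =
    - (k + 2 k^2 + k^3). Comparing norms forces k = 0. *)
Lemma neg_square_eq0_small b k : rnorm b <= 1 -> star b ** b = - k -> ispos k ->
  b = 0.
Proof.
move=> b1 bk kp; pose q := b ** star b.
have qp : ispos q by exact: ispos_mul_star bk kp.
have q1 : rnorm (cone - q) <= 1.
  rewrite -(scale1r (cone : A)); apply: isposP2 => //.
  rewrite (le_trans (rnormM _ _))// rnorm_star.
  by rewrite -expr2 expr_le1.
have sk := ispos_selfadj kp.
set N := rnorm k.
have bN : rnorm b ^+ 2 = N by rewrite -rnorm_starM bk rnormN.
pose z := b ** (cone + k).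
have zE : z = (cone - q) ** b.
  by rewrite cmulBl cmul1l -cmulA bk cmulNr opprK /z cmulDr cmul1r.
have zN : rnorm z ^+ 2 <= N.
  rewrite -bN lerXn2r ?nnegrE// zE (le_trans (rnormM _ _))//.
  by rewrite ler_piMl.
pose w := k + (k ** k + k ** k) + k ** k ** k.
have wE : star z ** z = - w.
  rewrite /z starM starD star1 sk -cmulA (cmulA (star b)) bk.
  rewrite cmulNl cmulNr; congr (- _).
  rewrite !cmulDr !cmulDl !cmul1l !cmul1r /w !cmulA; module.
have wN : rnorm w <= N by rewrite -rnormN -wE rnorm_starM.
have [s [/ispos_selfadj ss ks _]] := ispos_root kp.
have k3 : ispos (k ** k ** k).
  by exists (s ** k); [apply: selfadjM|]; rewrite // ks !cmulA.
have N0 : 0 <= N by exact: rnorm_ge0.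
(* From k + 2 k^2 <= N and 2 (k - N)^2 >= 0 follows (1 + 4 N) k <= N + 2 N^2. *)
pose v := k - sc N.
have vp : ispos (v ** v) by exists v => //; apply: selfadjB => //; exact: selfadj_sc.
have sw : selfadj w.
  by rewrite /w; do ?apply: selfadjD => //; do ?apply: selfadjM => //;rewrite ?cmulA.
have : ispos (sc (N + 2 * N ^+ 2) - (1 + 4 * N)%:C *: k).
  suff -> : sc (N + 2 * N ^+ 2) - (1 + 4 * N)%:C *: k =
     (sc (rnorm w) - w) + sc (N - rnorm w) + k ** k ** k + (2 : R)%:C *: (v ** v).
    apply: isposD; last exact: isposZ.
    do 2 ?apply: isposD => //.
      exact: ispos_rnormB.
    by apply: ispos_sc; rewrite subr_ge0.
  rewrite scD scD /v /w !cmulE; module.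
have h4 : 0 <= 1 + 4 * N by lra.
have h5 : 0 <= N + 2 * N ^+ 2 by rewrite addr_ge0// mulr_ge0// sqr_ge0.
move/(ispos_rnorm_le_sc h5 (isposZ h4 kp)); rewrite rnormZ ger0_norm//.
rewrite -/N => h2; have N20 : N ^+ 2 <= 0 by move: h2; rewrite expr2; nra.
have : rnorm b ^+ 2 = 0.
  rewrite bN; apply/eqP; have : N ^+ 2 == 0 by rewrite eq_le N20 sqr_ge0.
  by rewrite sqrf_eq0.
by move/eqP; rewrite sqrf_eq0 rnorm_eq0 => /eqP.
Qed.

Lemma neg_square_eq0 b k : star b ** b = - k -> ispos k -> b = 0.
Proof.
move=> bk kp; have [->//|b0] := eqVneq b 0.
have n0 : 0 < rnorm b by rewrite lt_def rnorm_eq0 b0 rnorm_ge0.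
pose t := (rnorm b)^-1.
have t0 : 0 < t by rewrite invr_gt0.
have : t%:C *: b = 0.
  apply: (@neg_square_eq0_small _ ((t ^+ 2)%:C *: k)).
  - by rewrite rnormZ gtr0_norm// mulVf// gt_eqF.
  - by rewrite starZr cmulZl cmulZr scalerA -rmorphM /= -expr2 bk scalerN.
  - by apply: isposZ => //; exact: sqr_ge0.
move=> /eqP; rewrite -rnorm_eq0 rnormZ gtr0_norm// mulf_eq0 !gt_eqF//.
Qed.

(** With h = star a ** a and u the square root of h^2, the element b = a (u - h)
    satisfies star b ** b = - u (u - h)^2, the opposite of a positive element.
    Hence b = 0, which gives h = u. *)
Theorem ispos_starM a : ispos (star a ** a).
Proof.
set h := star a ** a; have sh : selfadj h by exact: selfadj_starM.
have hhp : ispos (h ** h) by exists h.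
have [u [up hu cu]] := ispos_root hhp; have su := ispos_selfadj up.
have [v [/ispos_selfadj sv uv cv]] := ispos_root up.
have chu : h ** u = u ** h by apply: cu; rewrite cmulA.
have chv : h ** v = v ** h by exact: cv.
have cuv : u ** v = v ** u by rewrite uv cmulA.
pose g := u - h; have sg : selfadj g by exact: selfadjB.
have cvg : v ** g = g ** v by rewrite /g cmulBl cmulBr cuv chv.
have cug : u ** g = g ** u by rewrite /g cmulBl cmulBr chu.
have hg : h ** g = - (u ** g) by rewrite /g !cmulBr hu chu opprB.
pose b := a ** g.
have bE : star b ** b = - ((v ** g) ** (v ** g)).
  rewrite /b starM sg -cmulA (cmulA (star a)) -/h hg cmulNr; congr (- _).
  by rewrite cmulA -cug uv -!cmulA; congr (_ ** _); rewrite !cmulA cvg.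
have svg : selfadj (v ** g) by exact: selfadjM.
have b0 : b = 0 by apply: neg_square_eq0 bE _; exists (v ** g).
have vg0 : v ** g = 0.
  apply/eqP; rewrite -rnorm_eq0 -sqrf_eq0 -rnorm_sq//.
  by rewrite -(opprK (_ ** _)) -bE b0 cmul0r oppr0 rnorm0.
have ug0 : u ** g = 0 by rewrite uv -cmulA vg0 cmul0r.
have g0 : g = 0.
  apply/eqP; rewrite -rnorm_eq0 -sqrf_eq0 -rnorm_sq//.
  by rewrite {1}/g cmulBl hg ug0 !oppr0 addr0 rnorm0.
have -> : h = u by apply/eqP; rewrite eq_sym -subr_eq0 -/g g0.
exact: up.
Qed.

End Positivity.

(** * The Hahn-Banach theorem *)

Section HahnBanach.
Context {R : realType} {V : lmodType R[i]}.
Implicit Types (p q : V -> R) (x y v : V) (t : R).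

(** Sublinear functionals for the real structure of a complex space. *)
Definition sublinear q := (forall x y, q (x + y) <= q x + q y) /\
  (forall t x, 0 <= t -> q (t%:C *: x) <= t * q x).

(** Real linear functionals on a complex space. *)
Definition real_linear q := (forall x y, q (x + y) = q x + q y) /\
  (forall t x, q (t%:C *: x) = t * q x).

Lemma real_linearN q x : real_linear q -> q (- x) = - q x.
Proof. by move=> [_ qZ]; rewrite -mulN1r -qZ rmorphN /= scaleN1r. Qed.

Lemma sublinear0 q : sublinear q -> q 0 = 0.
Proof.
move=> [qD qZ]; apply/eqP; rewrite eq_le; apply/andP; split.
  by have := qZ 0 0 (lexx 0); rewrite scaler0 mul0r.
by have := qD 0 0; rewrite addr0; lra.
Qed.

Lemma sublinearN q x : sublinear q -> - q (- x) <= q x.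
Proof. by move=> qs; have := qs.1 x (- x); rewrite subrr sublinear0//; lra. Qed.

Lemma sublinearZ q t x : sublinear q -> 0 <= t -> q (t%:C *: x) = t * q x.
Proof.
move=> qs; rewrite le_eqVlt => /orP[/eqP<-|t0].
  by rewrite scale0r mul0r sublinear0.
apply/eqP; rewrite eq_le qs.2 ?(ltW t0)//= -ler_pdivlMl//.
rewrite (le_trans _ (qs.2 _ _ _)) ?invr_ge0 ?(ltW t0)//.
by rewrite scalerA -rmorphM /= mulVf ?gt_eqF// scale1r.
Qed.

(** Both the lower bound of a chain and the perturbation of a sublinear
    functional along a vector are pointwise infima of such a family. *)
Lemma sublinear_inf (I : Type) (D : set I) (g : I -> V -> R) (b : V -> R) :
  D !=set0 -> (forall i x, D i -> b x <= g i x) ->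
  (forall i j x y, D i -> D j -> exists2 k, D k & g k (x + y) <= g i x + g j y) ->
  (forall i t x, D i -> 0 <= t -> exists2 k, D k & g k (t%:C *: x) <= t * g i x) ->
  let q x := inf [set g i x | i in D] in
  sublinear q /\ forall i x, D i -> q x <= g i x.
Proof.
move=> [i0 Di0] gb gD gZ q.
have qle i x : D i -> q x <= g i x.
  move=> Di; apply: ge_inf; last by exists i.
  by exists (b x) => _ [j Dj <-]; exact: gb.
have qge x m : (forall i, D i -> m <= g i x) -> m <= q x.
  move=> h; apply: lb_le_inf; first by exists (g i0 x), i0.
  by move=> _ [j Dj <-]; exact: h.
split=> //; split=> [x y|t x].
  rewrite -lerBlDr; apply: (qge x) => i Di; rewrite lerBlDr [leRHS]addrC -lerBlDr.
  apply: qge => j Dj; rewrite lerBlDr [leRHS]addrC.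
  by have [k Dk h] := gD i j x y Di Dj; rewrite (le_trans (qle k _ _)).
rewrite le_eqVlt => /orP[/eqP t0|t0].
  have [k Dk h] := gZ i0 0 x Di0 (lexx 0).
  by rewrite -t0 (le_trans (qle k _ Dk))// (le_trans h)// !mul0r.
rewrite -ler_pdivrMl//; apply: qge => i Di; rewrite ler_pdivrMl//.
by have [k Dk h] := gZ i t x Di (ltW t0); rewrite (le_trans (qle k _ Dk)).
Qed.

(** The functional q' x = inf over t >= 0 of q (x + t v) - t q v. *)
Lemma sublinear_perturb q v : sublinear q -> exists q',
  [/\ sublinear q', forall x, q' x <= q x & q' (- v) <= - q v].
Proof.
move=> qs; pose g t x := q (x + t%:C *: v) - t * q v.
have [||i j x y i0 j0|i t x i0 t0|gs gle] :=
    @sublinear_inf _ [set t | 0 <= t] g (fun x => - q (- x)).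
- by exists 0 => /=.
- move=> t x t0; rewrite /g lerBrDr -sublinearZ//.
  have := qs.1 (- x) (x + t%:C *: v).
  by rewrite addrA addNr add0r => ?; rewrite addrC lerBlDl.
- exists (i + j) => /=; first exact: addr_ge0.
  rewrite /g rmorphD /= scalerDl addrACA mulrDl.
  by have := qs.1 (x + i%:C *: v) (y + j%:C *: v); lra.
- exists (t * i) => /=; first exact: mulr_ge0.
  by rewrite /g rmorphM /= -scalerA -scalerDr sublinearZ// mulrBr mulrA.
eexists; split; first exact: gs.
- move=> x; rewrite (le_trans (gle 0 x _))//= /g.
  by rewrite scale0r addr0 mul0r subr0.
- rewrite (le_trans (gle 1 _ _))//= /g.
  by rewrite scale1r addNr sublinear0// mul1r add0r.
Qed.

(** A sublinear functional that is minimal for the pointwise order is odd, by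
    sublinear_perturb, hence linear. *)
Lemma hahn_banach p : sublinear p ->
  exists2 f, real_linear f & forall x, f x <= p x.
Proof.
move=> ps; pose T := {q | sublinear q /\ forall x, q x <= p x}.
pose t0 : T := exist _ p (conj ps (fun x => lexx (p x))).
pose below (a b : T) := `[< forall x, sval b x <= sval a x >].
have [||A Atot|[f [fs fp]] fmin] := @ZL_preorder T t0 below.
- by move=> a; apply/asboolP => x.
- move=> a b c /asboolP ab /asboolP bc; apply/asboolP => x.
  exact: le_trans (bc x) (ab x).
- have [->|/set0P A0] := eqVneq A set0; first by exists t0.
  have [|i j x y Ai Aj|i t x Ai t_ge0|gs gle] :=
    @sublinear_inf _ A (fun a : T => sval a) (fun x => - p (- x)) A0.
  + move=> [q [qs qp]] x Aq /=; rewrite (le_trans _ (sublinearN x qs))//.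
    by rewrite lerN2.
  + have [/asboolP ij|/asboolP ji] := Atot _ _ Ai Aj.
    * exists j => //; case: i j ij Ai Aj => [q [qs qp]] [r [rs rp]] /= ij _ _.
      by rewrite (le_trans (rs.1 _ _))// lerD2r.
    * exists i => //; case: i j ji Ai Aj => [q [qs qp]] [r [rs rp]] /= ji _ _.
      by rewrite (le_trans (qs.1 _ _))// lerD2l.
  + by exists i => //; case: i Ai => [q [qs qp]] /= _; exact: qs.2.
  case: (A0) => a Aa; have gp x : inf [set sval i x | i in A] <= p x.
    by rewrite (le_trans (gle _ x Aa))//; case: (a) => q [].
  exists (exist _ (fun x => _) (conj gs gp) : T) => s As; apply/asboolP => x /=; exact: gle.
exists f => //.
have fN v : f (- v) = - f v.
  have [q [qs qf qv]] := sublinear_perturb v fs.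
  have qp x : q x <= p x by exact: le_trans (qf x) (fp x).
  have /asboolP/= fq : below (exist _ q (conj qs qp) : T) (exist _ f (conj fs fp) : T).
    by apply: fmin; apply/asboolP.
  apply/eqP; rewrite eq_le (le_trans (fq _) qv)/=.
  by have := sublinearN v fs; lra.
split=> [x y|t x].
  apply/eqP; rewrite eq_le fs.1 /=.
  by have := fs.1 (- x) (- y); rewrite -opprD !fN; lra.
have [t_ge0|/ltW t_le0] := leP 0 t; first exact: sublinearZ.
have := @sublinearZ f (- t) x fs; rewrite oppr_ge0 => /(_ t_le0).
by rewrite rmorphN /= scaleNr fN mulNr => /oppr_inj.
Qed.

Lemma hahn_banach_at p v : sublinear p ->
  exists f, [/\ real_linear f, forall x, f x <= p x & f v = p v].
Proof.
move=> ps; have [q [qs qp qv]] := sublinear_perturb v ps.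
have [f fl fq] := hahn_banach qs; exists f; split=> //.
  by move=> x; exact: le_trans (fq x) (qp x).
have fp : f v <= p v by exact: le_trans (fq v) (qp v).
apply/eqP; rewrite eq_le fp /=.
by have := le_trans (fq (- v)) qv; rewrite real_linearN//; lra.
Qed.

End HahnBanach.

(** * States *)

Section States.
Context {R : realType} {A : cstarAlgType R}.
Implicit Types (a b c h k : A) (t : R) (phi : {scalar A}).

Local Notation sc t := (t%:C *: (cone : A)).

Lemma half_double a : a = (2^-1)%:C *: (a + a).
Proof.
rewrite scalerDr -scalerDl -rmorphD /= (_ : 2^-1 + 2^-1 = 1) ?scale1r//.
by field.
Qed.

Lemma selfadj_split a : exists x y, [/\ selfadj x, selfadj y & a = x + 'i%C *: y].
Proof.
exists ((2^-1)%:C *: (a + star a)), ((2^-1)%:C *: ('i%C *: (star a - a))); split.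
- by apply: selfadjZ; rewrite /selfadj starD starK addrC.
- by apply: selfadjZ; rewrite /selfadj starZi starB starK -scalerN opprB.
- rewrite (scalerA 'i%C) (mulrC 'i%C) -scalerA (scalerA 'i%C) -expr2 sqr_i.
  by rewrite scaleN1r [LHS]half_double; module.
Qed.

Lemma rnorm_scD h t : 0 <= t -> ispos h -> rnorm (sc t + h) = t + rnorm h.
Proof.
move=> t0 hp; apply/eqP; rewrite eq_le; apply/andP; split.
  by rewrite (le_trans (rnormD _ _))// rnormZ1 ger0_norm.
have shp : ispos (sc t + h) by apply: isposD => //; exact: ispos_sc.
have pB := ispos_rnormB (ispos_selfadj shp).
have tn : t <= rnorm (sc t + h).
  rewrite -[leLHS]ger0_norm// -(@rnormZ1 _ A); apply: ispos_rnorm_le.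
    exact: ispos_sc.
  by rewrite addrC addKr.
rewrite -lerBrDl; apply: ispos_rnorm_le_sc => //; first by rewrite subr_ge0.
by rewrite rmorphB /= scalerBl -addrA -opprD.
Qed.

Lemma normalized_functional_ge0 (f : A -> R) : real_linear f ->
  (forall a, f a <= rnorm a) -> f cone = 1 -> forall h, ispos h -> 0 <= f h.
Proof.
move=> fl fn f1 h hp; have := le_trans (fn _) (isposP2 hp (lexx _)).
by rewrite fl.1 fl.2 real_linearN// f1; lra.
Qed.

(** The complex linear functional that agrees with a real linear functional f on
    self-adjoint elements: f (Re a) + i f (Im a). *)
Definition complexify (f : A -> R) a : R[i] :=
  f ((2^-1)%:C *: (a + star a)) +i* f ((2^-1)%:C *: ('i%C *: (star a - a))).

Lemma complexify_scalar (f : A -> R) : real_linear f -> scalar (complexify f).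
Proof.
move=> [fD fZ] c a b; set r := complex.Re c; set s := complex.Im c.
have cE : c = r%:C + 'i%C * s%:C by exact: complexE.
have sE : star (c *: a + b) = (r%:C - 'i%C * s%:C) *: star a + star b.
  rewrite starD starZ; congr (_ *: _ + _); rewrite cE.
  by apply/eqP; rewrite eq_complex /=; apply/andP; split; apply/eqP; ring.
have ii : sqz_scal 'i%C ^+ 2 = - 1 :> sqz_ext A.
  by rewrite -rmorphXn /= sqr_i rmorphN1.
rewrite /complexify sE.
have -> : (2^-1)%:C *: (c *: a + b + ((r%:C - 'i%C * s%:C) *: star a + star b))
    = r%:C *: ((2^-1)%:C *: (a + star a)) +
      (- s)%:C *: ((2^-1)%:C *: ('i%C *: (star a - a))) +
      (2^-1)%:C *: (b + star b).
  by rewrite cE; module.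
have -> : (2^-1)%:C *: ('i%C *: ((r%:C - 'i%C * s%:C) *: star a + star b -
      (c *: a + b)))
    = r%:C *: ((2^-1)%:C *: ('i%C *: (star a - a))) +
      s%:C *: ((2^-1)%:C *: (a + star a)) +
      (2^-1)%:C *: ('i%C *: (star b - b)).
  rewrite cE; apply: sqz_in_inj; rewrite !(sqz_inD, sqz_inN, sqz_inZ).
  by ring: ii.
rewrite !fD !(fZ r) !(fZ s) !(fZ (- s)) [c in RHS]complexE -/r -/s.
by apply/eqP; rewrite eq_complex /=; apply/andP; split; apply/eqP; ring.
Qed.

Lemma complexify_selfadj (f : A -> R) a : real_linear f -> selfadj a ->
  complexify f a = (f a)%:C.
Proof.
move=> [fD fZ] sa; rewrite /complexify sa subrr scaler0 fZ fZ fD.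
have -> : f 0 = 0 by rewrite -(scale0r (0 : A)) fZ mul0r.
by rewrite mulr0; congr (_ +i* _); field.
Qed.

(** Positive elements are normed by states: a functional of norm one that
    attains the norm of 1 + h takes the value 1 at 1 and the norm of h at h. *)
Lemma norming_state h : ispos h ->
  exists2 phi, is_state phi & phi h = (rnorm h)%:C.
Proof.
move=> hp; have sn : sublinear (fun a : A => rnorm a).
  split=> [a b|t a t0]; first exact: rnormD.
  by rewrite rnormZ ger0_norm.
have [f [fl fn fv]] := hahn_banach_at (cone + h) sn.
have := fv; rewrite fl.1 -{2}(scale1r cone) rnorm_scD// => fE.
have f1 : f cone = 1.
  by have := fn cone; have := fn h; rewrite rnorm1; lra.
have fh : f h = rnorm h by move: fE; rewrite f1; lra.
have fp := normalized_functional_ge0 fl fn f1.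
pose phi : {scalar A} := HB.pack (complexify f)
  (GRing.isLinear.Build _ _ _ _ _ (complexify_scalar fl)).
exists phi; last by rewrite /phi /= complexify_selfadj ?fh//; exact: ispos_selfadj.
split=> [a|]; rewrite /phi /=.
  rewrite complexify_selfadj//; last exact: selfadj_starM.
  by rewrite ler0c fp//; exact: ispos_starM.
by rewrite complexify_selfadj// ?f1//; exact: selfadj1.
Qed.

Lemma state_ge0 phi h : is_state phi -> ispos h -> 0 <= phi h.
Proof. by move=> [phi0 _] [s ss ->]; rewrite -{1}ss. Qed.

Lemma state_Im0 phi h : is_state phi -> selfadj h -> complex.Im (phi h) = 0.
Proof.
move=> phis sh.
have h1 : ispos (sc (rnorm h) - h) by exact: ispos_rnormB.
have h2 : ispos (sc (rnorm h)) by apply: ispos_sc.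
rewrite -(subKr (sc (rnorm h)) h) raddfB /= raddfB /=.
by rewrite !ger0_Im ?subr0//; exact: state_ge0.
Qed.

Lemma state_star phi a : is_state phi -> phi (star a) = conjc (phi a).
Proof.
move=> phis; have [x [y [sx sy ->]]] := selfadj_split a.
rewrite starD starZi sx sy.
have := state_Im0 phis sx; have := state_Im0 phis sy.
rewrite raddfB raddfD /= !linearZ /=.
case: (phi x) => x1 x2; case: (phi y) => y1 y2 /= -> ->.
by apply/eqP; rewrite eq_complex /=; apply/andP; split; apply/eqP; ring.
Qed.

Lemma rnorm_sqrC (z : R[i]) : (rnorm z ^+ 2)%:C = z * conjc z.
Proof.
by rewrite rmorphXn /= -sqr_normc; congr (_ ^+ 2).
Qed.

Lemma state_cauchy_schwarz phi a : is_state phi ->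
  rnorm (phi a) ^+ 2 <= complex.Re (phi (star a ** a)).
Proof.
move=> phis; set z := phi a.
have := phis.1 (a - z *: cone).
have -> : star (a - z *: cone) ** (a - z *: cone) =
    star a ** a - z *: star a - conjc z *: a + (z * conjc z) *: cone.
  by rewrite starB starZ star1 -[Num.conj z]/(conjc z) !cmulE; module.
rewrite raddfD !raddfB /= !linearZ /= phis.2 state_star// -/z mulr1.
rewrite -!addrA (_ : z *: - conjc z + _ = - (z * conjc z)); last first.
  by rewrite -[_ *: - conjc z]/(z * - conjc z) -[_ *: - z]/(conjc z * - z); ring.
rewrite -rnorm_sqrC lecE => /andP[_].
by case: (phi (star a ** a)) => u v /=; rewrite subr_ge0.
Qed.

Lemma state_Re_le phi h k : is_state phi -> ispos (k - h) ->
  complex.Re (phi h) <= complex.Re (phi k).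
Proof.
move=> phis /(state_ge0 phis); rewrite raddfB /= lecE => /andP[_].
by case: (phi k) => ? ?; case: (phi h) => ? ? /=; rewrite subr_ge0.
Qed.

Lemma state_Re_le_rnorm phi h : is_state phi -> selfadj h ->
  complex.Re (phi h) <= rnorm h.
Proof.
move=> phis sh; have := state_Re_le phis (ispos_rnormB sh).
by rewrite linearZ /= phis.2 mulr1.
Qed.

Lemma rnorm_state phi a : is_state phi -> rnorm (phi a) <= rnorm a.
Proof.
move=> phis; rewrite -(@ler_pXn2r _ 2)// ?nnegrE// -(rnorm_starM a).
rewrite (le_trans (state_cauchy_schwarz a phis))//.
by apply: state_Re_le_rnorm => //; exact: selfadj_starM.
Qed.

Lemma state_cauchy_schwarz_star phi a : is_state phi ->
  rnorm (phi a) ^+ 2 <= complex.Re (phi (a ** star a)).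
Proof.
move=> phis; have := state_cauchy_schwarz (star a) phis.
rewrite starK state_star//; suff -> : rnorm (conjc (phi a)) = rnorm (phi a) by [].
by rewrite /rnorm normcJ.
Qed.

End States.

(** * Inner products over finite sets of indices and in the standard module *)

Section FiniteInner.
Context {R : realType} {A : cstarAlgType R}.
Implicit Types (a b c h k : A) (t : R).

Local Notation sc t := (t%:C *: (cone : A)).

Lemma ispos_cjg a h : ispos h -> ispos (star a ** h ** a).
Proof.
move=> [s ss ->]; have := ispos_starM (s ** a).
by rewrite starM ss !cmulA.
Qed.

Lemma isposB_cjg a h k : ispos (k - h) ->
  ispos (star a ** k ** a - star a ** h ** a).
Proof. by move/(ispos_cjg a); rewrite cmulBr cmulBl. Qed.

(** The inner product of two families over a finite list of indices. *)
Definition fdot (I : Type) (r : seq I) (x y : I -> A) : A :=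
  \sum_(i <- r) star (x i) ** y i.

Section Fdot.
Context {I : Type} (r : seq I).
Implicit Types x y z : I -> A.

Lemma star_fdot x y : star (fdot r x y) = fdot r y x.
Proof. by rewrite /fdot star_sum; apply: eq_bigr => i _; rewrite starM starK. Qed.

Lemma ispos_fdot x : ispos (fdot r x x).
Proof. by apply: ispos_sum => i _; exact: ispos_starM. Qed.

Lemma fdotBr x y z : fdot r x (y - z) = fdot r x y - fdot r x z.
Proof. by rewrite /fdot -sumrB; apply: eq_bigr => i _; rewrite -cmulBr. Qed.

Lemma fdotBl x y z : fdot r (x - y) z = fdot r x z - fdot r y z.
Proof. by rewrite -star_fdot fdotBr starB !star_fdot. Qed.

Lemma fdotZr t x y : fdot r x (fun i => t%:C *: y i) = t%:C *: fdot r x y.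
Proof. by rewrite /fdot scaler_sumr; apply: eq_bigr => i _; rewrite cmulZr. Qed.

Lemma fdotZl t x y : fdot r (fun i => t%:C *: x i) y = t%:C *: fdot r x y.
Proof. by rewrite -star_fdot fdotZr starZr star_fdot. Qed.

Lemma fdot_ractr x y a : fdot r x (ract y a) = fdot r x y ** a.
Proof. by rewrite /fdot cmul_suml; apply: eq_bigr => i _; rewrite cmulA. Qed.

Lemma fdot_ractl x y a : fdot r (ract x a) y = star a ** fdot r x y.
Proof. by rewrite -star_fdot fdot_ractr starM star_fdot. Qed.

(** Cauchy-Schwarz inequality in the algebra: with a = <v, u>, the difference
    is, up to a factor t, the sum of <t u - v a, t u - v a> and of
    star a ** (t - <v, v>) ** a. *)
Lemma fdot_cauchy_schwarz u v t : 0 < t -> rnorm (fdot r v v) <= t ->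
  ispos (t%:C *: fdot r u u - fdot r u v ** fdot r v u).
Proof.
move=> t0 vt; set a := fdot r v u; have av : fdot r u v = star a.
  by rewrite star_fdot.
pose z := (fun i => t%:C *: u i) - ract v a.
have -> : t%:C *: fdot r u u - fdot r u v ** a =
    (t^-1)%:C *: (fdot r z z + (star a ** sc t ** a - star a ** fdot r v v ** a)).
  have zE : fdot r z z = t%:C *: (t%:C *: fdot r u u - star a ** a - star a ** a)
      + star a ** fdot r v v ** a.
    rewrite /z fdotBl !fdotBr !fdotZl !fdotZr fdot_ractl !fdot_ractr fdot_ractl.
    by rewrite -/a av; module.
  rewrite zE av !cmulE.
  transitivity ((t^-1)%:C *: (t%:C *: (t%:C *: fdot r u u - star a ** a))).
    by rewrite scalerA -rmorphM /= mulVf ?gt_eqF// scale1r.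
  by congr (_ *: _); module.
apply: isposZ; first by rewrite invr_ge0 ltW.
apply: isposD; first exact: ispos_fdot.
apply: isposB_cjg; rewrite -(subrK (sc (rnorm (fdot r v v))) (sc t)) -addrA.
apply: isposD; last exact/ispos_rnormB/ispos_selfadj/ispos_fdot.
by rewrite -scalerBl -rmorphB; apply: ispos_sc; rewrite subr_ge0.
Qed.

Lemma rnorm_fdot_le x y :
  rnorm (fdot r x y) ^+ 2 <= rnorm (fdot r x x) * rnorm (fdot r y y).
Proof.
rewrite -(rnorm_star (fdot _ _ _)) -rnorm_starM starK star_fdot.
set N := rnorm (fdot r y y).
(* The inequality holds for every positive t >= N, also when N = 0. *)
have h t : 0 < t -> N <= t ->
    rnorm (fdot r x y ** fdot r y x) <= t * rnorm (fdot r x x).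
  move=> t0 tN; rewrite -[t in leRHS]gtr0_norm// -rnormZ.
  apply: ispos_rnorm_le; last exact: fdot_cauchy_schwarz.
  by rewrite -star_fdot; exact: ispos_starM.
have N0 : 0 <= N by exact: rnorm_ge0.
apply/ler_addgt0Pr => e e0.
pose d := e / (rnorm (fdot r x x) + 1).
have x1 : 0 < rnorm (fdot r x x) + 1 by rewrite ltr_wpDl.
have d0 : 0 < d by rewrite divr_gt0.
rewrite (le_trans (h (N + d) _ _))//; [by rewrite ltr_wpDl|by rewrite lerDl ltW|].
rewrite mulrDl mulrC lerD2l /d mulrAC ler_pdivrMr// ler_pM2l//.
by rewrite lerDl.
Qed.

End Fdot.

Lemma fdot_coord_le (I : finType) (u : I -> A) i :
  rnorm (u i) ^+ 2 <= rnorm (fdot (index_enum I) u u).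
Proof.
rewrite -rnorm_starM; apply: ispos_rnorm_le; first exact: ispos_starM.
rewrite /fdot (bigD1 i)//= [X in X - _]addrC addrK.
by apply: ispos_sum => j _; exact: ispos_starM.
Qed.

End FiniteInner.

Section Sequences.
Context {R : realType} {A : cstarAlgType R}.
Implicit Types (u v : nat -> A).

Lemma cvg_series_rnormP u : cvgn (series u) <->
  forall e : R, 0 < e -> exists N, forall m n, (N <= m)%N -> (m <= n)%N ->
    rnorm (\sum_(m <= k < n) u k) < e.
Proof.
split=> [/cvg_cauchy_rnorm h e /h[N hN]|h]; last first.
  apply: complete_cauchy => e /h[N hN]; exists N => m n Nm mn.
  by rewrite sub_series_geq// hN.
exists N => m n Nm mn.
by rewrite -sub_series_geq// hN// (leq_trans Nm).
Qed.

End Sequences.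

Section StandardModuleTheory.
Context {R : realType} {A : cstarAlgType R}.
Implicit Types (x y z : nat -> A) (a : A) (t : R) (n m : nat).

Local Notation HA := (@Defs.HA R A).
Local Notation pdot n x y := (fdot (index_iota 0 n) x y).

Lemma rnorm_fdot_sqrt (I : Type) (r : seq I) (x y : I -> A) :
  rnorm (fdot r x y) <=
  Num.sqrt (rnorm (fdot r x x)) * Num.sqrt (rnorm (fdot r y y)).
Proof.
rewrite -sqrtrM// -(ger0_norm (rnorm_ge0 (fdot r x y))) -sqrtr_sqr.
by rewrite ler_wsqrtr// rnorm_fdot_le.
Qed.

Lemma cvg_pdot x y : HA x -> HA y ->
  (fun n => pdot n x y) @ \oo --> hdot x y.
Proof.
move=> /cvg_series_rnormP hx /cvg_series_rnormP hy.
have : cvgn (series (fun j => star (x j) ** y j)).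
  apply/cvg_series_rnormP => e e0.
  have [N1 h1] := hx e e0; have [N2 h2] := hy e e0.
  exists (maxn N1 N2) => m n; rewrite geq_max => /andP[m1 m2] mn.
  rewrite -(@ltr_pXn2r _ 2)// ?nnegrE// ?(ltW e0)//.
  rewrite (le_lt_trans (rnorm_fdot_le _ _ _))// expr2.
  by rewrite ltr_pM// ?h1 ?h2.
exact.
Qed.

Lemma HA0 : HA 0.
Proof.
apply/cvg_series_rnormP => e e0; exists 0%N => m n _ _.
by rewrite big1 ?rnorm0// => i _; rewrite cmul0r.
Qed.

Lemma HAD x y : HA x -> HA y -> HA (x + y).
Proof.
move=> hx hy; apply/cvg_ex; eexists.
have -> : series (fun j => star ((x + y) j) ** (x + y) j) =
    (fun n => (pdot n x x + pdot n x y) + (pdot n y x + pdot n y y)).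
  apply/funext => n; rewrite /series /= /fdot -!big_split; apply: eq_bigr => i _.
  by rewrite /= starD !cmulE.
apply: cvgD; (apply: cvgD; exact: cvg_pdot).
Qed.

Lemma HA_ract x a : HA x -> HA (ract x a).
Proof.
move=> hx; apply/cvg_ex; eexists.
have -> : series (fun j => star (ract x a j) ** ract x a j) =
    (fun n => star a ** pdot n x x ** a).
  by apply/funext => n; rewrite -cmulA -fdot_ractr -fdot_ractl.
apply: cvg_cmul; last exact: cvg_cst.
by apply: cvg_cmul; [exact: cvg_cst|exact: cvg_pdot].
Qed.

Lemma HAN x : HA x -> HA (- x).
Proof.
move=> hx; have := @HA_ract x (- cone) hx; congr (HA _).
by apply/funext => j; rewrite /ract cmulNr cmul1r.
Qed.

Lemma HAB x y : HA x -> HA y -> HA (x - y).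
Proof. by move=> hx hy; apply: HAD => //; exact: HAN. Qed.

Lemma HA_sum (I : Type) (r : seq I) (F : I -> nat -> A) :
  (forall i, HA (F i)) -> HA (\sum_(i <- r) F i).
Proof. by move=> h; elim/big_ind : _ => //; [exact: HA0|exact: HAD]. Qed.

(** A sequence with finitely many nonzero terms. *)
Lemma HA_finite x n : (forall j, (n <= j)%N -> x j = 0) -> HA x.
Proof.
move=> xn; apply/cvg_series_rnormP => e e0; exists n => m k nm _.
rewrite big_nat big1 ?rnorm0// => i /andP[mi _].
by rewrite xn ?cmul0r// (leq_trans nm).
Qed.

Lemma star_hdot x y : HA x -> HA y -> star (hdot x y) = hdot y x.
Proof.
move=> hx hy; apply: (cvg_unique_rnorm (cvg_star (cvg_pdot hx hy))).
by under eq_fun do rewrite star_fdot; exact: cvg_pdot.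
Qed.

Lemma hdotDr x y z : HA x -> HA y -> HA z ->
  hdot x (y + z) = hdot x y + hdot x z.
Proof.
move=> hx hy hz; apply: (cvg_unique_rnorm (cvg_pdot hx (HAD hy hz))).
have -> : (fun n => pdot n x (y + z)) = (fun n => pdot n x y + pdot n x z).
  apply/funext => n; rewrite /fdot -big_split; apply: eq_bigr => i _.
  by rewrite -[(y + z) i]/(y i + z i) cmulDr.
by apply: cvgD; exact: cvg_pdot.
Qed.

Lemma hdot_ractr x y a : HA x -> HA y -> hdot x (ract y a) = hdot x y ** a.
Proof.
move=> hx hy; apply: (cvg_unique_rnorm (cvg_pdot hx (@HA_ract _ a hy))).
under eq_fun do rewrite fdot_ractr.
by apply: cvg_cmul; [exact: cvg_pdot|exact: cvg_cst].
Qed.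

Lemma hdotDl x y z : HA x -> HA y -> HA z ->
  hdot (x + y) z = hdot x z + hdot y z.
Proof.
move=> hx hy hz; have hxy := HAD hx hy.
by rewrite -star_hdot// hdotDr// starD !star_hdot.
Qed.

Lemma hdotNr x y : HA x -> HA y -> hdot x (- y) = - hdot x y.
Proof.
move=> hx hy; rewrite -[RHS]cmul1r cmulNl -cmulNr -hdot_ractr//.
by congr (hdot x _); apply/funext => j; rewrite /ract cmulNr cmul1r.
Qed.

Lemma hdotNl x y : HA x -> HA y -> hdot (- x) y = - hdot x y.
Proof.
move=> hx hy; have hNx := HAN hx.
by rewrite -star_hdot// hdotNr// starN star_hdot.
Qed.

Lemma hdotBl x y z : HA x -> HA y -> HA z ->
  hdot (x - y) z = hdot x z - hdot y z.
Proof. by move=> hx hy hz; rewrite hdotDl ?hdotNl//; exact: HAN. Qed.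

Lemma hdot0l y : HA y -> hdot 0 y = 0.
Proof. by move=> hy; rewrite -(subrr (0 : nat -> A)) hdotBl ?subrr//; exact: HA0. Qed.

Lemma hdot_suml (I : Type) (r : seq I) (F : I -> nat -> A) y :
  (forall i, HA (F i)) -> HA y ->
  hdot (\sum_(i <- r) F i) y = \sum_(i <- r) hdot (F i) y.
Proof.
move=> hF hy; elim: r => [|i r IH]; first by rewrite !big_nil hdot0l.
by rewrite !big_cons hdotDl ?IH//; exact: HA_sum.
Qed.

Lemma hdot_sumr (I : Type) (r : seq I) (F : I -> nat -> A) y :
  (forall i, HA (F i)) -> HA y ->
  hdot y (\sum_(i <- r) F i) = \sum_(i <- r) hdot y (F i).
Proof.
move=> hF hy; have hs := @HA_sum _ r _ hF.
rewrite -star_hdot// hdot_suml// star_sum.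
by apply: eq_bigr => i _; rewrite star_hdot.
Qed.

Lemma ispos_hdot x : HA x -> ispos (hdot x x).
Proof.
move=> hx; apply: ispos_cvg (cvg_pdot hx hx) => n; exact: ispos_fdot.
Qed.

Lemma hnorm_ge0 x : 0 <= hnorm x. Proof. exact: sqrtr_ge0. Qed.

Lemma hnorm_sqr x : hnorm x ^+ 2 = rnorm (hdot x x).
Proof. by rewrite sqr_sqrtr. Qed.

Lemma rnorm_hdot_sqr_le x y : HA x -> HA y ->
  rnorm (hdot x y) ^+ 2 <= rnorm (hdot x x) * rnorm (hdot y y).
Proof.
move=> hx hy; rewrite expr2 -subr_ge0.
have cx := cvg_rnorm (cvg_pdot hx hx); have cy := cvg_rnorm (cvg_pdot hy hy).
have cxy := cvg_rnorm (cvg_pdot hx hy).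
apply: (cvgr_to_ge (cvgB (cvgM cx cy) (cvgM cxy cxy))); near=> n.
by have := rnorm_fdot_le (index_iota 0 n) x y; rewrite expr2 -subr_ge0.
Unshelve. all: by end_near. Qed.

Lemma rnorm_hdot_le x y : HA x -> HA y -> rnorm (hdot x y) <= hnorm x * hnorm y.
Proof.
move=> hx hy; rewrite -(@ler_pXn2r _ 2)// ?nnegrE ?mulr_ge0 ?hnorm_ge0//.
by rewrite exprMn !hnorm_sqr rnorm_hdot_sqr_le.
Qed.

(** Parallelogram law, without the term of the difference. *)
Lemma hnormD_sqr x y : HA x -> HA y ->
  hnorm (x + y) ^+ 2 <= 2 * hnorm x ^+ 2 + 2 * hnorm y ^+ 2.
Proof.
move=> hx hy; rewrite !hnorm_sqr.
apply: (@le_trans _ _ (rnorm ((2 : R)%:C *: hdot x x + (2 : R)%:C *: hdot y y))).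
  apply: ispos_rnorm_le; first exact/ispos_hdot/HAD.
  have hNy := HAN hy; have := ispos_hdot (HAB hx hy); congr (ispos _).
  have -> : hdot (x - y) (x - y) = hdot x x - hdot x y - hdot y x + hdot y y.
    rewrite hdotBl ?(hdotDr hx hx hNy) ?(hdotDr hy hx hNy) ?hdotNr//.
      by rewrite opprB addrA addrAC.
    exact: HAD.
  have -> : hdot (x + y) (x + y) = hdot x x + hdot x y + hdot y x + hdot y y.
    rewrite hdotDl ?(hdotDr hx hx hy) ?(hdotDr hy hx hy) ?addrA//.
    exact: HAD.
  by module.
by rewrite (le_trans (rnormD _ _))// !rnormZ ger0_norm.
Qed.

Lemma hnormN x : HA x -> hnorm (- x) = hnorm x.
Proof.
by move=> hx; rewrite /hnorm hdotNl ?hdotNr ?opprK//; exact: HAN.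
Qed.

Lemma hnormB_sqr x y : HA x -> HA y ->
  hnorm (x - y) ^+ 2 <= 2 * hnorm x ^+ 2 + 2 * hnorm y ^+ 2.
Proof. by move=> hx hy; rewrite -(hnormN hy) hnormD_sqr//; exact: HAN. Qed.

End StandardModuleTheory.

(** * The seminorms and their finite partial sums *)

Section Seminorm.
Context {R : realType} {A : cstarAlgType R}.
Implicit Types (x y z w : nat -> A) (X : nat -> nat -> A).

Local Notation HA := (@Defs.HA R A).

Lemma cstar_leP (a b : A) : cstar_le a b <-> ispos (b - a).
Proof.
split=> [[c ->]|[s ss sE]]; first exact: ispos_starM.
by exists s; rewrite ss.
Qed.

(** The positive element sum_(m <= i < n) <x, x_i><x_i, x>. *)
Definition window X m n x : A :=
  \sum_(m <= i < n) hdot x (X i) ** hdot (X i) x.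

(** Partial sums of |phi <x, x_i>|^2. The square of the seminorm is their supremum
    over m and n, where phi is the m-th state. *)
Definition state_sum X (phi : {scalar A}) m n x : R :=
  \sum_(m <= i < n) rnorm (phi (hdot x (X i))) ^+ 2.

Lemma windowE X m n x : (forall i, HA (X i)) -> HA x ->
  window X m n x =
  fdot (index_iota m n) (fun i => hdot (X i) x) (fun i => hdot (X i) x).
Proof.
by move=> hX hx; rewrite /window /fdot; apply: eq_bigr => i _; rewrite star_hdot.
Qed.

Lemma ispos_window X m n x : (forall i, HA (X i)) -> HA x ->
  ispos (window X m n x).
Proof. by move=> hX hx; rewrite windowE//; exact: ispos_fdot. Qed.

Lemma state_sum_window X phi m n x : (forall i, HA (X i)) -> is_state phi ->
  HA x -> state_sum X phi m n x <= rnorm (window X m n x).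
Proof.
move=> hX hphi hx.
apply: le_trans (state_Re_le_rnorm hphi (ispos_selfadj (ispos_window m n hX hx))).
rewrite /state_sum /window raddf_sum /= raddf_sum /=.
apply: ler_sum => i _; rewrite -(star_hdot hx (hX i)).
exact: state_cauchy_schwarz_star.
Qed.

(** Admissibility bounds the windows by the square of the norm. *)
Lemma window_le X m n x : admissible X -> HA x ->
  rnorm (window X m n x) <= hnorm x ^+ 2.
Proof.
move=> [hX Xcvg Xle _] hx; rewrite hnorm_sqr.
set u := fun i => hdot x (X i) ** hdot (X i) x.
have up i : ispos (u i) by rewrite /u -star_hdot//; exact: ispos_starM.
have [nm|mn] := leqP n m; first by rewrite /window big_geq// rnorm0.
apply: (@le_trans _ _ (rnorm (series u n))).
  apply: ispos_rnorm_le; first exact: ispos_window.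
  rewrite /series /= /window (big_cat_nat (leq0n m) (ltnW mn))/=.
  by rewrite addrK; apply: ispos_sum => i _; exact: up.
apply: (@le_trans _ _ (rnorm (limn (series u)))).
  apply: ispos_rnorm_le; first by apply: ispos_sum => i _; exact: up.
  have hl : (fun k => series u (k + n) - series u n) @ \oo -->
      limn (series u) - series u n.
    apply: cvgB; last exact: cvg_cst.
    by rewrite (cvg_shiftn n (series u)); exact: Xcvg.
  apply: ispos_cvg hl => k.
  rewrite sub_series_geq ?leq_addl//.
  by apply: ispos_sum => i _; exact: up.
apply: ispos_rnorm_le; last exact/cstar_leP/Xle.
apply: ispos_cvg (Xcvg _ hx) => k.
by apply: ispos_sum => i _; exact: up.
Qed.

Lemma state_sum_le X phi m n x : admissible X -> is_state phi -> HA x ->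
  state_sum X phi m n x <= hnorm x ^+ 2.
Proof.
move=> hX hphi hx; apply: le_trans (window_le m n hX hx).
by case: hX => hX _ _ _; exact: state_sum_window.
Qed.

Lemma state_sum_ge0 X phi m n x : 0 <= state_sum X phi m n x.
Proof. by apply: sumr_ge0 => i _; exact: sqr_ge0. Qed.

Lemma state_sum_split X phi m k n x :
  state_sum X phi m n x <= state_sum X phi m k x + state_sum X phi k n x.
Proof.
have [mk|km] := leqP m k; have [kn|nk] := leqP k n.
- by rewrite /state_sum (big_cat_nat mk kn).
- have [mn|/ltnW nm] := leqP m n.
    rewrite [X in _ <= X + _]/state_sum (big_cat_nat mn (ltnW nk)) /=.
    by rewrite -addrA lerDl addr_ge0// state_sum_ge0.
  by rewrite {1}/state_sum big_geq// addr_ge0// state_sum_ge0.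
- have [mn|nm] := leqP m n; last first.
    by rewrite {1}/state_sum big_geq ?(ltnW nm)// addr_ge0// state_sum_ge0.
  rewrite [X in _ <= _ + X]/state_sum (big_cat_nat (ltnW km) mn) /=.
  by rewrite addrA lerDr addr_ge0// state_sum_ge0.
- rewrite {1}/state_sum big_geq ?addr_ge0 ?state_sum_ge0//.
  by rewrite (leq_trans (ltnW nk))// ltnW.
Qed.

(** A substitute for the triangle inequality of the seminorm, at the level of the
    squares: (a + b)^2 <= (1 + t) a^2 + (1 + 1 / t) b^2. *)
Lemma state_sumD X (phi : {scalar A}) m n x y (t : R) : (forall i, HA (X i)) ->
  HA x -> HA y -> 0 < t ->
  state_sum X phi m n (x + y) <=
  (1 + t) * state_sum X phi m n x + (1 + t^-1) * state_sum X phi m n y.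
Proof.
move=> hX hx hy t0; rewrite /state_sum !mulr_sumr -big_split /=.
apply: ler_sum => i _; rewrite hdotDl// raddfD /=.
set p := phi _; set q := phi _.
apply: (@le_trans _ _ ((rnorm p + rnorm q) ^+ 2)).
  by rewrite lerXn2r ?nnegrE ?addr_ge0 ?rnormD.
rewrite -subr_ge0 (_ : _ - _ = (t * rnorm p - rnorm q) ^+ 2 / t).
  by rewrite divr_ge0 ?sqr_ge0// ltW.
by field; rewrite gt_eqF.
Qed.

Lemma seminorm_lt X (phi : nat -> {scalar A}) x (B e : R) : 0 < e -> B < e ^+ 2 ->
  (forall k n, state_sum X (phi k) k n x <= B) ->
  (seminorm X phi x < e%:E)%E.
Proof.
move=> e0 Be hB.
have B0 : 0 <= B by apply: le_trans (hB 0 0); exact: state_sum_ge0.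
apply: (@le_lt_trans _ _ (sqrte B%:E)).
  rewrite /seminorm lee_sqrt ?lee_fin//; apply: ge_ereal_sup => _ [k _ <-].
  apply: lime_le.
    by apply: is_cvg_nneseries => n _ _; rewrite lee_fin sqr_ge0.
  by near=> n; rewrite sumEFin lee_fin; exact: hB.
rewrite /= lte_fin -[ltRHS]gtr0_norm// -sqrtr_sqr ltr_sqrt//.
by rewrite exprn_gt0.
Unshelve. all: by end_near. Qed.

Lemma seminorm_ge X (phi : nat -> {scalar A}) x k :
  ((rnorm (phi k (hdot x (X k))))%:E <= seminorm X phi x)%E.
Proof.
rewrite -[rnorm _]ger0_norm// -sqrtr_sqr -[(_)%:E]/(sqrte _%:E) /seminorm.
set S := ereal_sup _.
have tS : ((rnorm (phi k (hdot x (X k))) ^+ 2)%:E <= S)%E.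
  apply: (@le_trans _ _ (\sum_(k <= i <oo)
      (rnorm (phi k (hdot x (X i))) ^+ 2)%:E)%E); last first.
    by apply: ereal_sup_ubound; exists k.
  apply: le_trans (nneseries_lim_ge k.+1 _).
    by rewrite big_nat1.
  by move=> i _ _; rewrite lee_fin sqr_ge0.
by rewrite lee_sqrt// (le_trans _ tS)// lee_fin sqr_ge0.
Qed.

End Seminorm.

(** A set on which finitely many bounded functions are given is totally bounded for
    them. Points are sorted into cells according to the integer parts of the
    rescaled values; one representative is kept in each occupied cell. *)
Lemma finite_net (R : realType) (T : Type) (I : finType) (S : set T) (f : I -> T -> R)
    (C d : R) : 0 < d -> (forall i x, S x -> `|f i x| <= C) ->
  exists (m : nat) (y : 'I_m -> T), (forall j, S (y j)) /\
    forall x, S x -> exists j, forall i, `|f i x - f i (y j)| <= d.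
Proof.
move=> d0 fC; have [->|/set0P[x0 Sx0]] := eqVneq S set0.
  exists 0%N; unshelve eexists; first by case.
  by split=> [[]|x].
pose lev i x := Num.truncn ((f i x + C) / d).
pose B := Num.truncn ((C + C) / d).
pose code x : {ffun I -> 'I_B.+1} := [ffun i => inord (lev i x)].
have pos i x : S x -> 0 <= (f i x + C) / d.
  by move=> /(fC i); rewrite ler_norml => /andP[h _]; rewrite divr_ge0 ?(ltW d0)//; lra.
have levB i x : S x -> (lev i x < B.+1)%N.
  move=> Sx; rewrite ltnS /lev /B.
  have /andP[h1 _] := truncn_itv (pos i x Sx).
  have CC : 0 <= (C + C) / d.
    rewrite divr_ge0 ?(ltW d0)//.
    by have := le_trans (normr_ge0 _) (fC i x Sx); lra.
  rewrite -ltnS -(ltr_nat R); have /andP[_] := truncn_itv CC.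
  apply: le_lt_trans; apply: le_trans h1 _.
  rewrite ler_pM2r ?invr_gt0// lerD2r.
  exact: le_trans (ler_norm _) (fC i x Sx).
pose rep (c : {ffun I -> 'I_B.+1}) : T :=
  if pselect (exists x, S x /\ code x = c) is left h then projT1 (cid h) else x0.
have repS c : S (rep c).
  by rewrite /rep; case: pselect => // h; case: (cid h) => /= x [].
have repc x : S x -> code (rep (code x)) = code x.
  move=> Sx; rewrite /rep; case: pselect => [h|[]]; last by exists x.
  by case: (cid h) => /= y [].
exists #|{ffun I -> 'I_B.+1}|, (fun j => rep (enum_val j)); split=> // x Sx.
exists (enum_rank (code x)) => i; rewrite enum_rankK.
set y := rep _; have Sy : S y by exact: repS.
have /ffunP/(_ i) : code y = code x by exact: repc.
rewrite !ffunE => /(congr1 val); rewrite /= !inordK ?levB// /lev => E.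
have /andP[x1 x2] := truncn_itv (pos i x Sx).
have /andP[y1 y2] := truncn_itv (pos i y Sy).
move: x1 x2 y1 y2; rewrite E -addn1 natrD; set k := (_ %:R : R) => x1 x2 y1 y2.
have : `|(f i x + C) / d - (f i y + C) / d| <= 1 by rewrite ler_norml; lra.
rewrite -mulrBl opprD addrACA subrr addr0 normrM.
by rewrite (gtr0_norm (_ : 0 < d^-1)) ?invr_gt0// ler_pdivrMr// mul1r.
Qed.

Section TotallyBounded.
Context {R : realType} {A : cstarAlgType R}.
Implicit Types (x y z w : nat -> A) (X : nat -> nat -> A).

Local Notation HA := (@Defs.HA R A).

(** The norm of a family over a finite list of indices. *)
Definition fnorm (I : Type) (r : seq I) (x : I -> A) : R :=
  Num.sqrt (rnorm (fdot r x x)).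

Lemma fnorm_ge0 (I : Type) (r : seq I) (x : I -> A) : 0 <= fnorm r x.
Proof. exact: sqrtr_ge0. Qed.

Lemma fnorm_sqr (I : Type) (r : seq I) (x : I -> A) :
  fnorm r x ^+ 2 = rnorm (fdot r x x).
Proof. by rewrite sqr_sqrtr. Qed.

Lemma fnormD (I : Type) (r : seq I) (x y : I -> A) :
  fnorm r (x + y) <= fnorm r x + fnorm r y.
Proof.
rewrite -(@ler_pXn2r _ 2)// ?nnegrE ?addr_ge0 ?fnorm_ge0// fnorm_sqr.
have -> : fdot r (x + y) (x + y) =
    (fdot r x x + fdot r x y) + (fdot r y x + fdot r y y).
  rewrite /fdot -!big_split; apply: eq_bigr => i _.
  by rewrite -[(x + y) i]/(x i + y i) starD !cmulE.
have h1 := rnorm_fdot_sqrt r x y; have h2 := rnorm_fdot_sqrt r y x.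
rewrite (le_trans (rnormD _ _))// sqrrD !fnorm_sqr.
have h3 := rnormD (fdot r x x) (fdot r x y).
have h4 := rnormD (fdot r y x) (fdot r y y).
by move: h1 h2 h3 h4; rewrite -/(fnorm r x) -/(fnorm r y); lra.
Qed.

Lemma fnorm_ract (I : Type) (r : seq I) (x : I -> A) (a : A) :
  fnorm r (ract x a) <= fnorm r x * rnorm a.
Proof.
rewrite -(@ler_pXn2r _ 2)// ?nnegrE ?mulr_ge0 ?fnorm_ge0// exprMn !fnorm_sqr.
rewrite fdot_ractl fdot_ractr cmulA (le_trans (rnormM _ _))//.
rewrite expr2 mulrA ler_wpM2r// (le_trans (rnormM _ _))//.
by rewrite rnorm_star mulrC.
Qed.

Lemma fnorm_sum (I J : Type) (r : seq I) (s : seq J) (F : J -> I -> A) :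
  fnorm r (\sum_(j <- s) F j) <= \sum_(j <- s) fnorm r (F j).
Proof.
elim: s => [|j s IH]; last by rewrite !big_cons (le_trans (fnormD _ _ _))// lerD2l.
rewrite !big_nil /fnorm (_ : fdot _ _ _ = 0) ?rnorm0 ?sqrtr0//.
by rewrite /fdot big1// => i _; rewrite cmul0r.
Qed.

End TotallyBounded.

(** * Bounded sets in free finitely generated submodules *)

Section ChiLeLambda.
Context {R : realType} {A : cstarAlgType R}.
Implicit Types (x y z w : nat -> A) (X : nat -> nat -> A) (L : set (nat -> A)).

Local Notation HA := (@Defs.HA R A).

Lemma rnorm_sqr_ReIm (z : R[i]) :
  rnorm z ^+ 2 = complex.Re z ^+ 2 + complex.Im z ^+ 2.
Proof.
have : (rnorm z ^+ 2)%:C = (complex.Re z ^+ 2 + complex.Im z ^+ 2)%:C.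
  by rewrite add_Re2_Im2 rmorphXn /= rnormE.
by case.
Qed.

Lemma normr_Re_le (z : R[i]) : `|complex.Re z| <= rnorm z.
Proof.
rewrite -(@ler_pXn2r _ 2)// ?nnegrE// rnorm_sqr_ReIm real_normK ?num_real//.
by rewrite lerDl sqr_ge0.
Qed.

Lemma normr_Im_le (z : R[i]) : `|complex.Im z| <= rnorm z.
Proof.
rewrite -(@ler_pXn2r _ 2)// ?nnegrE// rnorm_sqr_ReIm real_normK ?num_real//.
by rewrite lerDr sqr_ge0.
Qed.

(** A free finitely generated module has finitely many generators over which
    every element has coordinates bounded by a multiple of its norm. *)
Lemma free_fg_generators L : L `<=` HA -> free_fg L ->
  exists (n : nat) (g : 'I_n -> nat -> A) (M : R),
    [/\ 0 <= M, forall l, L (g l) & forall w, L w -> exists u : 'I_n -> A,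
      w = \sum_l ract (g l) (u l) /\ forall l, rnorm (u l) <= M * hnorm w].
Proof.
move=> LHA [n [T [[TL _ LT] TD Tact _ [M TM]]]].
pose e (l : 'I_n) : 'I_n -> A := fun j => if j == l then cone else 0.
exists n, (fun l => T (e l)), `|M|; split=> // [l|w /LT[u _ uw]].
  by apply: TL.
exists u; split.
  have T0 : T 0 = 0 by apply: (addrI (T 0)); rewrite -TD !addr0.
  rewrite -uw -[in LHS](_ : \sum_l ract (e l) (u l) = u).
    by rewrite (big_morph T TD T0); apply: eq_bigr => l _; rewrite Tact.
  apply/funext => j; rewrite fct_sumE (bigD1 j)//= big1 ?addr0.
    by rewrite /ract /e eqxx cmul1l.
  by move=> l lj; rewrite /ract /e eq_sym (negbTE lj) cmul0l.
move=> l; apply: (@le_trans _ _ (anorm u)).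
  rewrite -(@ler_pXn2r _ 2)// ?nnegrE ?sqrtr_ge0// sqr_sqrtr//.
  exact: fdot_coord_le.
rewrite -uw (le_trans (TM u))// ler_wpM2r ?hnorm_ge0//; exact: ler_norm.
Qed.

(** For each generator the tails of the admissibility series tend to 0 in norm,
    and the coordinates over the generators are bounded on bounded sets. *)
Lemma window_tail_small X L (D t : R) : admissible X -> L `<=` HA -> free_fg L ->
  0 <= D -> 0 < t -> exists K, forall w, L w -> hnorm w <= D ->
  forall (phi : {scalar A}), is_state phi ->
  forall m n, (K <= m)%N -> state_sum X phi m n w <= t.
Proof.
move=> [hX Xcvg _ _] LHA Lfree D0 t0.
have [N [g [M [M0 Lg gM]]]] := free_fg_generators LHA Lfree.
pose d := Num.sqrt t / (N%:R * (M * D) + 1).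
have q0 : 0 <= N%:R * (M * D) by rewrite !mulr_ge0.
have d0 : 0 < d by rewrite divr_gt0 ?sqrtr_gt0// ltr_wpDl.
have /fin_all_exists[Kf hK] (l : 'I_N) : exists K, forall m n,
    (K <= m)%N -> fnorm (index_iota m n) (fun i => hdot (X i) (g l)) <= d.
  have [K hK] := (cvg_series_rnormP _).1 (Xcvg _ (LHA _ (Lg l))) _ (exprn_gt0 2 d0).
  exists K => m n Km.
  rewrite -(@ler_pXn2r _ 2)// ?nnegrE ?fnorm_ge0 ?(ltW d0)// fnorm_sqr.
  rewrite -windowE//; last exact: LHA.
  have [mn|nm] := leqP m n; first by apply/ltW/hK.
  by rewrite /window big_geq ?(ltnW nm)// rnorm0 sqr_ge0.
exists (\max_l Kf l)%N => w Lw wD phi hphi m n Km; have hw := LHA _ Lw.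
apply: (le_trans (state_sum_window m n hX hphi hw)).
rewrite windowE// -fnorm_sqr -(sqr_sqrtr (ltW t0)).
rewrite lerXn2r ?nnegrE ?fnorm_ge0 ?sqrtr_ge0//.
have [u [wE uM]] := gM w Lw.
have -> : (fun i => hdot (X i) w) =
    \sum_l ract (fun i => hdot (X i) (g l)) (u l).
  apply/funext => i; rewrite wE hdot_sumr//.
    by rewrite fct_sumE; apply: eq_bigr => l _; rewrite hdot_ractr//; exact: LHA.
  by move=> l; apply/HA_ract/LHA.
rewrite (le_trans (fnorm_sum _ _ _))//.
apply: (@le_trans _ _ (\sum_(l < N) d * (M * D))).
  apply: ler_sum => l _; rewrite (le_trans (fnorm_ract _ _ _))//.
  rewrite ler_pM ?fnorm_ge0 ?hK//.
    by rewrite (leq_trans _ Km)// leq_bigmax.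
  by rewrite (le_trans (uM l))// ler_wpM2l.
rewrite sumr_const card_ord -mulr_natl mulrCA /d mulrAC ler_pdivrMr.
  by rewrite ler_wpM2l ?sqrtr_ge0// lerDl.
by rewrite ltr_wpDl.
Qed.

(** Only the scalars phi_k <y, x_i> with k, i < K matter up to a uniformly small
    tail, and these range over a bounded subset of a finite-dimensional space. *)
Lemma free_fg_totally_bounded X (phi : nat -> {scalar A}) L (C e : R) :
  admissible X -> (forall k, is_state (phi k)) ->
  hilbert_submodule L -> free_fg L -> 0 < e ->
  exists (m : nat) (y : 'I_m -> nat -> A), (forall j, L (y j)) /\
    forall z, L z -> hnorm z <= C -> exists j, forall k n,
      state_sum X (phi k) k n (z - y j) <= e.
Proof.
move=> hX hphi [LHA _ LD Lract _] Lfree e0.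
have LB z w : L z -> L w -> L (z - w).
  move=> Lz Lw; apply: LD => //; have := Lract w (- cone) Lw; congr (L _).
  by apply/funext => j; rewrite /ract cmulNr cmul1r.
have e20 : 0 < e / 2 by rewrite divr_gt0.
have D0 : 0 <= 2 * `|C| by rewrite mulr_ge0.
have [K tailK] := window_tail_small hX LHA Lfree D0 e20.
have K1 : 0 < 4 * (K%:R + 1) :> R by rewrite mulr_gt0// ltr_wpDl.
pose d := Num.sqrt (e / (4 * (K%:R + 1))).
have d0 : 0 < d by rewrite sqrtr_gt0 divr_gt0.
have d2 : K%:R * (d ^+ 2 + d ^+ 2) <= e / 2.
  rewrite sqr_sqrtr ?divr_ge0 ?(ltW e0) ?(ltW K1)//.
  rewrite -subr_ge0 (_ : _ - _ = e / (2 * (K%:R + 1))).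
    by rewrite divr_ge0 ?(ltW e0)// mulr_ge0// addr_ge0.
  by field; rewrite gt_eqF// ltr_wpDl.
pose S : set (nat -> A) := [set z | L z /\ hnorm z <= C].
pose f (i : 'I_K * 'I_K * bool) z : R :=
  let c := phi i.1.1 (hdot z (X i.1.2)) in
  if i.2 then complex.Re c else complex.Im c.
have fC i z : S z -> `|f i z| <= C.
  move=> [Lz zC]; set c := phi i.1.1 (hdot z (X i.1.2)).
  have cC : rnorm c <= C.
    rewrite (le_trans (rnorm_state _ (hphi _)))//; case: hX => hX _ _ X1.
    rewrite (le_trans (rnorm_hdot_le (LHA _ Lz) (hX _)))//.
    by rewrite (le_trans _ zC)// ler_piMr ?hnorm_ge0.
  rewrite /f -/c; case: ifP => _; rewrite (le_trans _ cC)//.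
    exact: normr_Re_le.
  exact: normr_Im_le.
have [m [y [Sy ynet]]] := finite_net d0 fC.
exists m, y; split=> [j|z Lz zC]; first by case: (Sy j).
have [j zy] := ynet z (conj Lz zC).
exists j => k n; have [Ly yC] := Sy j.
have Lw : L (z - y j) by exact: LB.
have wD : hnorm (z - y j) <= 2 * `|C|.
  rewrite -(@ler_pXn2r _ 2)// ?nnegrE ?hnorm_ge0//.
  rewrite (le_trans (hnormB_sqr (LHA _ Lz) (LHA _ Ly)))// exprMn.
  have sq (s : R) : 0 <= s -> s <= C -> s ^+ 2 <= `|C| ^+ 2.
    move=> s0 sC; rewrite lerXn2r ?nnegrE//.
    by rewrite (le_trans sC)// ler_norm.
  have := sq _ (hnorm_ge0 z) zC; have := sq _ (hnorm_ge0 (y j)) yC; lra.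
have [Kk|kK] := leqP K k.
  by rewrite (le_trans (tailK _ Lw wD _ (hphi k) _ _ Kk))//; lra.
rewrite (le_trans (state_sum_split _ _ _ K _ _))//.
have := tailK _ Lw wD _ (hphi k) K n (leqnn K).
suff : state_sum X (phi k) k K (z - y j) <= e / 2 by lra.
apply: le_trans d2; apply: (@le_trans _ _ (\sum_(k <= i < K) (d ^+ 2 + d ^+ 2))).
  apply: ler_sum_nat => i /andP[ki iK].
  have hX' := hX; case: hX' => hX' _ _ _.
  rewrite rnorm_sqr_ReIm hdotBl ?raddfB//; [|exact: LHA|exact: LHA].
  have h1 := zy (Ordinal kK, Ordinal iK, true).
  have h2 := zy (Ordinal kK, Ordinal iK, false).
  move: h1 h2; rewrite /f /=.
  case: (phi k (hdot z (X i))) => p1 p2.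
  case: (phi k (hdot (y j) (X i))) => q1 q2 /= h1 h2.
  have sq (s : R) : `|s| <= d -> s ^+ 2 <= d ^+ 2.
    by move=> sd; rewrite -(real_normK (num_real s)) lerXn2r ?nnegrE// ltW.
  by rewrite lerD// sq.
rewrite sumr_const_nat -[leLHS]mulr_natl ler_wpM2r ?addr_ge0 ?sqr_ge0//.
by rewrite ler_nat leq_subr.
Qed.

End ChiLeLambda.

(** * The upper bound for the Hausdorff measure *)

Section UpperBound.
Context {R : realType} {A : cstarAlgType R}.
Implicit Types (x y z w : nat -> A) (X : nat -> nat -> A) (L E : set (nat -> A)).

Local Notation HA := (@Defs.HA R A).

Lemma hausdorff_le_of_free X (phi : nat -> {scalar A}) L E (e : R) :
  admissible X -> (forall k, is_state (phi k)) -> hbounded E ->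
  hilbert_submodule L -> free_fg L -> 0 < e ->
  (ereal_sup [set ereal_inf [set (hnorm (x - y))%:E | y in L] | x in E]
     < e%:E)%E ->
  (hausdorff_mnc (seminorm X phi) E <= e%:E)%E.
Proof.
move=> hX hphi [EHA [M EM]] hL Lfree e0 supe.
have [s [s0 se Es]] : exists s : R, [/\ 0 < s, s < e
    & forall x, E x -> exists2 y, L y & hnorm (x - y) < s].
  set S := ereal_sup _ in supe.
  have [s [s0 se Ss]] : exists s : R, [/\ 0 < s, s < e & (S < s%:E)%E].
    case: S supe => [r|//|_]; last first.
      by exists (e / 2); split; rewrite ?ltNyr//; lra.
    rewrite lte_fin => re; exists (Num.max ((r + e) / 2) (e / 2)).
    rewrite lt_max gt_max lte_fin lt_max; split; [apply/orP; right|apply/andP; split|apply/orP; left]; lra.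
  exists s; split => // x Ex.
  have : (ereal_inf [set (hnorm (x - y))%:E | y in L] < s%:E)%E.
    by apply: le_lt_trans Ss; apply: ereal_sup_ubound; exists x.
  by move=> /ereal_inf_lt[_ [y Ly <-]]; rewrite lte_fin; exists y.
have LHA : L `<=` HA by case: hL.
have s2 : 0 < s ^+ 2 by rewrite exprn_gt0.
have se2 : s ^+ 2 < e ^+ 2 by rewrite ltrXn2r// ?nnegrE ltW.
(* The constants satisfy (1 + t) s^2 + (1 + 1 / t) d = (3 e^2 + s^2) / 4 < e^2. *)
pose t := (e ^+ 2 - s ^+ 2) / (2 * s ^+ 2).
have t0 : 0 < t by rewrite divr_gt0 ?subr_gt0 ?mulr_gt0.
pose d := (e ^+ 2 - s ^+ 2) / (4 * (1 + t^-1)).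
have t1 : 0 < 1 + t^-1 by rewrite addr_gt0 ?invr_gt0.
have d0 : 0 < d by rewrite divr_gt0 ?subr_gt0 ?mulr_gt0.
pose C := Num.sqrt (2 * `|M| ^+ 2 + 2 * s ^+ 2).
have [m [y [Ly ynet]]] :=
  free_fg_totally_bounded C hX hphi hL Lfree d0.
apply: ereal_inf_lbound; exists e => //; split=> //.
exists m, y; split=> [j|x Ex]; first exact: LHA.
have [w Lw xw] := Es x Ex.
have hx := EHA x Ex; have hw := LHA w Lw; have hxw := HAB hx hw.
have xw2 : hnorm (x - w) ^+ 2 <= s ^+ 2.
  by rewrite lerXn2r ?nnegrE ?hnorm_ge0// ltW.
have wC : hnorm w <= C.
  rewrite -(ger0_norm (hnorm_ge0 w)) -sqrtr_sqr ler_wsqrtr//.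
  have := hnormB_sqr hx hxw; rewrite opprB addrC subrK.
  have : hnorm x ^+ 2 <= `|M| ^+ 2.
    rewrite lerXn2r ?nnegrE ?hnorm_ge0//.
    by rewrite (le_trans (EM x Ex))// ler_norm.
  by lra.
have [j wy] := ynet w Lw wC; have hy := LHA _ (Ly j).
exists j => //; split=> //.
apply: (@seminorm_lt _ _ _ _ _ ((1 + t) * s ^+ 2 + (1 + t^-1) * d)) => //.
  have -> : (1 + t) * s ^+ 2 = s ^+ 2 + (e ^+ 2 - s ^+ 2) / 2.
    by rewrite /t; field; rewrite gt_eqF.
  have -> : (1 + t^-1) * d = (e ^+ 2 - s ^+ 2) / 4.
    by rewrite /d; move: (1 + t^-1) t1 => c c0; field; rewrite gt_eqF.
  by lra.
move=> k n; have -> : x - y j = (x - w) + (w - y j) by rewrite addrA subrK.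
have hX' := hX; case: hX' => hX' _ _ _.
have hwy := HAB hw hy.
rewrite (le_trans (state_sumD _ _ _ hX' hxw hwy t0))// lerD//.
  rewrite ler_wpM2l ?addr_ge0 ?(ltW t0)// (le_trans _ xw2)//.
  exact: state_sum_le.
by rewrite ler_wpM2l ?(ltW t1)// wy.
Qed.

Lemma chi_star_le_lambda E : hbounded E -> (chi_star E <= lambda_mnc E)%E.
Proof.
move=> hE; apply: ge_ereal_sup => _ [X [phi [hX hphi ->]]].
apply: le_ereal_inf_tmp => _ [e [e0 [L [hL Lfree Le]]] <-].
exact: hausdorff_le_of_free Le.
Qed.

End UpperBound.

(** * The submodules of the first coordinates *)

Section CoordinateModules.
Context {R : realType} {A : cstarAlgType R}.
Implicit Types (x y z : nat -> A).

Local Notation HA := (@Defs.HA R A).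

Lemma ispos_hdot_pdot x n : HA x ->
  ispos (hdot x x - fdot (index_iota 0 n) x x).
Proof.
move=> hx; have h : (fun k => fdot (index_iota 0 (k + n)) x x
    - fdot (index_iota 0 n) x x) @ \oo --> hdot x x - fdot (index_iota 0 n) x x.
  apply: cvgB; last exact: cvg_cst.
  rewrite (cvg_shiftn n (fun k => fdot (index_iota 0 k) x x)).
  exact: cvg_pdot.
apply: ispos_cvg h => k; rewrite /fdot (big_cat_nat (leq0n n) (leq_addl k n)) /=.
by rewrite [X in X - _]addrC addrK; apply: ispos_sum => i _; exact: ispos_starM.
Qed.

Lemma rnorm_coord_le x j : HA x -> rnorm (x j) <= hnorm x.
Proof.
move=> hx; rewrite -(@ler_pXn2r _ 2)// ?nnegrE ?hnorm_ge0// hnorm_sqr.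
rewrite -(rnorm_starM (x j)); apply: ispos_rnorm_le; first exact: ispos_starM.
rewrite -(subrK (fdot (index_iota 0 j.+1) x x) (hdot x x)) -addrA.
apply: isposD; first exact: ispos_hdot_pdot.
rewrite /fdot big_nat_recr//= addrK.
by apply: ispos_sum => i _; exact: ispos_starM.
Qed.

Lemma hdot_support x y m n : HA x -> HA y -> (m <= n)%N ->
  (forall j, ~~ (m <= j < n)%N -> y j = 0) ->
  hdot x y = fdot (index_iota m n) x y.
Proof.
move=> hx hy mn y0; apply: (cvg_unique_rnorm (cvg_pdot hx hy)).
rewrite -(cvg_shiftn n (fun k => fdot (index_iota 0 k) x y)).
have -> : (fun k => fdot (index_iota 0 (k + n)) x y) =
    (fun=> fdot (index_iota m n) x y); last exact: cvg_cst.
apply/funext => k; rewrite /fdot.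
rewrite (big_cat_nat (leq0n n) (leq_addl k n)) /= (big_cat_nat (leq0n m) mn) /=.
rewrite [X in X + _ + _]big_nat [X in X + _ + _]big1 ?add0r; last first.
  by move=> i /andP[_ im]; rewrite y0 ?cmul0r// leqNgt im.
rewrite [X in _ + X]big_nat [X in _ + X]big1 ?addr0//.
by move=> i /andP[ni _]; rewrite y0 ?cmul0r// ltnNge ni andbF.
Qed.

(** The submodule of the first n coordinates. *)
Definition coords n : set (nat -> A) := [set x | forall j, (n <= j)%N -> x j = 0].

Lemma coords_HA n : coords n `<=` HA.
Proof. by move=> x /HA_finite. Qed.

Lemma coords_hilbert n : hilbert_submodule (coords n).
Proof.
split.
- exact: coords_HA.
- by [].
- by move=> x y xn yn j nj; rewrite -[LHS]/(x j + y j) xn// yn// addr0.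
- by move=> x a xn j nj; rewrite /ract xn// cmul0l.
move=> x hx xcl j nj; apply/eqP; rewrite -rnorm_eq0 eq_le rnorm_ge0 andbT.
apply/ler_addgt0Pr => e e0; rewrite add0r.
have [y yn xy] := xcl e e0.
have -> : x j = (x - y) j by rewrite -[RHS]/(x j - y j) yn// subr0.
by rewrite (le_trans _ (ltW xy))// rnorm_coord_le//; apply/HAB/coords_HA/yn.
Qed.

(** Extension by zero of a finite family. *)
Definition pad n (u : 'I_n -> A) : nat -> A :=
  fun j => if insub j is Some i then u i else 0.

Lemma pad_ord n (u : 'I_n -> A) (i : 'I_n) : pad u i = u i.
Proof. by rewrite /pad valK. Qed.

Lemma pad_out n (u : 'I_n -> A) j : (n <= j)%N -> pad u j = 0.
Proof. by move=> nj; rewrite /pad insubF// ltnNge nj. Qed.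

Lemma hnorm_pad n (u : 'I_n -> A) : hnorm (pad u) = anorm u.
Proof.
have pc : coords n (pad u) by move=> j; exact: pad_out.
rewrite /hnorm (@hdot_support _ _ 0 n)//; [|exact: coords_HA pc..|]; last first.
  by move=> j; rewrite leq0n/= -leqNgt; exact: pad_out.
rewrite /anorm /fdot big_mkord; congr (Num.sqrt (rnorm _)).
by apply: eq_bigr => i _; rewrite pad_ord.
Qed.

Lemma coords_free n : free_fg (coords n).
Proof.
exists n, (@pad n); split.
- split; first by move=> u _ j; exact: pad_out.
    move=> u v _ _ uv; apply/funext => i.
    by rewrite -pad_ord uv pad_ord.
  move=> x xn; exists (fun i : 'I_n => x i) => //; apply/funext => j.
  have [jn|nj] := ltnP j n; last by rewrite pad_out// xn.
  by rewrite -[j]/(val (Ordinal jn)) pad_ord.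
- move=> u v; apply/funext => j.
  rewrite -[RHS]/(pad u j + pad v j) /pad.
  by case: insubP => [i _ _|_]//; rewrite addr0.
- move=> u a; apply/funext => j; rewrite /ract /pad.
  by case: insubP => [i _ _|_]//; rewrite cmul0l.
- by exists 1 => u; rewrite hnorm_pad mul1r.
- by exists 1 => u; rewrite hnorm_pad mul1r.
Qed.

End CoordinateModules.

(** * The lower bound for the Hausdorff measure *)

Section LowerBound.
Context {R : realType} {A : cstarAlgType R}.
Implicit Types (x y z : nat -> A) (E : set (nat -> A)).

Local Notation HA := (@Defs.HA R A).

(** Otherwise every element of E would be within distance r of its truncation
    to the first n coordinates. *)
Lemma tail_of_lt_lambda E (r : R) : E `<=` HA -> 0 < r ->
  (r%:E < lambda_mnc E)%E -> forall n, exists p : (nat -> A) * nat,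
  [/\ E p.1, (n < p.2)%N & r ^+ 2 < rnorm (fdot (index_iota n p.2) p.1 p.1)].
Proof.
move=> EHA r0 rl n; apply: contrapT => H.
suff : (lambda_mnc E <= r%:E)%E by rewrite leNgt rl.
have small x m : E x -> rnorm (fdot (index_iota n m) x x) <= r ^+ 2.
  move=> Ex; rewrite leNgt; apply/negP => h; apply: H; exists (x, m); split=> //=.
  rewrite ltnNge; apply/negP => mn; move: h.
  by rewrite /index_iota (eqP mn) /fdot big_nil rnorm0 ltNge sqr_ge0.
apply/lee_addgt0Pr => e e0; rewrite -EFinD.
apply: ereal_inf_lbound; exists (r + e) => //; split; first exact: addr_gt0.
exists (coords n); split; [exact: coords_hilbert|exact: coords_free|].
apply: (@le_lt_trans _ _ r%:E); last by rewrite lte_fin ltrDl.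
apply: ge_ereal_sup => _ [x Ex <-].
pose y j := if (j < n)%N then x j else 0.
have yn : coords n y by move=> j nj; rewrite /y ltnNge nj.
have hx := EHA x Ex; have hy := coords_HA yn; have hxy := HAB hx hy.
apply: (@le_trans _ _ (hnorm (x - y))%:E).
  by apply: ereal_inf_lbound; exists y.
rewrite lee_fin -(@ler_pXn2r _ 2)// ?nnegrE ?hnorm_ge0// ?(ltW r0)// hnorm_sqr.
apply: (cvg_rnorm_le (cvg_pdot hxy hxy)) => m.
suff -> : fdot (index_iota 0 m) (x - y) (x - y) = fdot (index_iota n m) x x.
  exact: small.
have lo j : (j < n)%N -> (x - y) j = 0.
  by move=> jn; rewrite -[LHS]/(x j - y j) /y jn subrr.
have hi j : (n <= j)%N -> (x - y) j = x j.
  by move=> nj; rewrite -[LHS]/(x j - y j) /y ltnNge nj subr0.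
have [nm|mn] := leqP n m; last first.
  rewrite {2}/fdot big_geq ?(ltnW mn)// /fdot big_nat big1// => i /andP[_ im].
  by rewrite lo ?cmul0r// (ltn_trans im).
rewrite /fdot (big_cat_nat (leq0n n) nm) /= big_nat big1 ?add0r.
  by apply: eq_big_nat => i /andP[ni _]; rewrite hi.
by move=> i /andP[_ im]; rewrite lo ?cmul0r.
Qed.

(** A block system: consecutive intervals [N k, N k+1) of indices, and vectors
    b k of norm at most one carried by them. *)
Section BlockSystem.
Variables (N : nat -> nat) (b : nat -> nat -> A).
Hypotheses (N0 : N 0 = 0%N) (Nlt : forall k, (N k < N k.+1)%N).
Hypothesis b0 : forall k j, ~~ (N k <= j < N k.+1)%N -> b k j = 0.
Hypothesis b1 : forall k, rnorm (fdot (index_iota (N k) (N k.+1)) (b k) (b k)) <= 1.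

Local Notation block k := (index_iota (N k) (N k.+1)).

Lemma block_ge k : (k <= N k)%N.
Proof. by elim: k => // k IH; exact: leq_ltn_trans (Nlt k). Qed.

Lemma block_homo m n : (m <= n)%N -> (N m <= N n)%N.
Proof.
move: m n; apply: (@homo_leq _ N (fun i j => i <= j)%N) => [//|j i k|k].
  exact: leq_trans.
exact/ltnW.
Qed.

Lemma block_HA k : HA (b k).
Proof.
by apply: (@HA_finite _ _ _ (N k.+1)) => j nj; rewrite b0// negb_and -leqNgt nj orbT.
Qed.

Lemma hdot_blockr x k : HA x -> hdot x (b k) = fdot (block k) x (b k).
Proof.
by move=> hx; apply: hdot_support => //; [exact: block_HA|exact/ltnW|exact: b0].
Qed.

Lemma hdot_blockl x k : HA x -> hdot (b k) x = fdot (block k) (b k) x.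
Proof.
move=> hx; have hb := @block_HA k.
by rewrite -star_hdot// hdot_blockr// star_fdot.
Qed.

Lemma fdot_blocks x m n : (m <= n)%N ->
  \sum_(m <= k < n) fdot (block k) x x = fdot (index_iota (N m) (N n)) x x.
Proof.
move=> /subnKC <-; elim: (n - m)%N => [|d IH].
  by rewrite addn0 big_geq// /fdot big_geq.
rewrite addnS big_nat_recr ?leq_addr//= IH /fdot.
rewrite -(big_cat_nat (F := fun i => star (x i) ** x i))//.
  by apply: block_homo; rewrite leq_addr.
exact/ltnW.
Qed.

(** Bessel inequality, from the Cauchy-Schwarz inequality on each block. *)
Lemma block_bessel x m n : HA x -> (m <= n)%N ->
  ispos (fdot (index_iota (N m) (N n)) x x -
    \sum_(m <= k < n) hdot x (b k) ** hdot (b k) x).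
Proof.
move=> hx mn; rewrite -fdot_blocks// -sumrB; apply: ispos_sum => k _.
rewrite hdot_blockr// hdot_blockl//.
have := @fdot_cauchy_schwarz _ _ _ (block k) x _ _ ltr01 (b1 k).
by rewrite scale1r.
Qed.

Lemma block_admissible : admissible b.
Proof.
have term_pos x i : HA x -> ispos (hdot x (b i) ** hdot (b i) x).
  by move=> hx; rewrite -(star_hdot (@block_HA i) hx); exact: ispos_starM.
have sumcvg x : HA x -> cvgn (series (fun i => hdot x (b i) ** hdot (b i) x)).
  move=> hx; apply/cvg_series_rnormP => e e0.
  have [K hK] := (cvg_series_rnormP _).1 hx e e0.
  exists K => m n Km mn; apply: (@le_lt_trans _ _
      (rnorm (fdot (index_iota (N m) (N n)) x x))).
    apply: ispos_rnorm_le; last exact: block_bessel.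
    by apply: ispos_sum => i _; exact: term_pos.
  apply: hK; last exact: block_homo.
  by rewrite (leq_trans Km)// block_ge.
split=> //.
- exact: block_HA.
- move=> x hx; apply/cstar_leP.
  have h : (fun n => fdot (index_iota 0 (N n)) x x -
      series (fun i => hdot x (b i) ** hdot (b i) x) n) @ \oo -->
      hdot x x - limn (series (fun i => hdot x (b i) ** hdot (b i) x)).
    apply: cvgB; last exact: sumcvg.
    apply/cvg_rnormP => e e0.
    have [K hK] := (cvg_rnormP _ _).1 (cvg_pdot hx hx) e e0.
    by exists K => n Kn; apply: hK; rewrite (leq_trans Kn)// block_ge.
  apply: ispos_cvg h => n.
  by have := block_bessel hx (leq0n n); rewrite N0.
- move=> i; rewrite -(@ler_pXn2r _ 2)// ?nnegrE ?hnorm_ge0// hnorm_sqr expr1n.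
  by rewrite hdot_blockr ?b1//; exact: block_HA.
Qed.

Lemma block_cvg0 x (e : R) : HA x -> 0 < e ->
  exists K, forall k, (K <= k)%N -> rnorm (hdot x (b k)) < e.
Proof.
move=> hx e0; have [K hK] := (cvg_series_rnormP _).1 hx _ (exprn_gt0 2 e0).
exists K => k Kk; rewrite -(@ltr_pXn2r _ 2)// ?nnegrE ?(ltW e0)//.
rewrite hdot_blockr// (le_lt_trans (rnorm_fdot_le _ _ _))//.
apply: (@le_lt_trans _ _ (rnorm (fdot (block k) x x))).
  by rewrite ler_piMr.
by apply: hK (ltnW (Nlt k)); rewrite (leq_trans Kk)// block_ge.
Qed.

End BlockSystem.

Lemma hausdorff_ge0 (p : (nat -> A) -> \bar R) E : (0 <= hausdorff_mnc p E)%E.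
Proof.
by apply: le_ereal_inf_tmp => _ [e [e0 _] <-]; rewrite lee_fin ltW.
Qed.

(** The zero system and any state give a seminorm, so that the supremum is not
    taken over the empty set. *)
Lemma chi_star_ge0 E : (0 <= chi_star E)%E.
Proof.
have [phi phis _] := norming_state (@ispos0 R A).
apply: le_trans (hausdorff_ge0 (seminorm (fun _ => 0) (fun _ => phi)) E) _.
apply: ereal_sup_ubound; exists (fun _ => 0), (fun _ => phi); split=> //.
have dot0 x : HA x -> (fun i : nat => hdot x 0 ** hdot 0 x) = (fun=> 0 : A).
  by move=> hx; rewrite hdot0l// cmul0r.
have ser0 : series (fun=> 0 : A) = (fun=> 0).
  by apply/funext => n; rewrite /series /= big1.
split.
- by move=> _; exact: HA0.
- by move=> x hx; rewrite dot0// ser0; exact: is_cvg_cst.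
- move=> x hx; rewrite dot0// ser0 lim_cst//; apply/cstar_leP.
  by rewrite subr0; exact: ispos_hdot.
- by move=> _; rewrite /hnorm hdot0l ?rnorm0 ?sqrtr0//; exact: HA0.
Qed.

(** The blocks of the vectors given by tail_of_lt_lambda, normalized, form an
    admissible system; the k-th state norms the k-th block. *)
Lemma chi_star_ge E (r : R) : E `<=` HA -> 0 < r -> (r%:E < lambda_mnc E)%E ->
  (r%:E <= chi_star E)%E.
Proof.
move=> EHA r0 rl; have /choice[F hF] := tail_of_lt_lambda EHA r0 rl.
pose N := fix N k := if k is k'.+1 then (F (N k')).2 else 0%N.
pose x k := (F (N k)).1.
have Nlt k : (N k < N k.+1)%N by have [] := hF (N k).
have Ex k : E (x k) by have [] := hF (N k).
pose h k := fdot (index_iota (N k) (N k.+1)) (x k) (x k).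
have hr k : r ^+ 2 < rnorm (h k) by have [] := hF (N k).
have h0 k : 0 < rnorm (h k) by rewrite (lt_trans _ (hr k))// exprn_gt0.
pose t k := (Num.sqrt (rnorm (h k)))^-1.
have t0 k : 0 < t k by rewrite invr_gt0 sqrtr_gt0.
pose b k j := if (N k <= j < N k.+1)%N then (t k)%:C *: x k j else 0.
have b0 k j : ~~ (N k <= j < N k.+1)%N -> b k j = 0.
  by rewrite /b => /negbTE ->.
have dotb y k : fdot (index_iota (N k) (N k.+1)) y (b k) =
    (t k)%:C *: fdot (index_iota (N k) (N k.+1)) y (x k).
  rewrite -fdotZr /fdot; apply: eq_big_nat => j /= Hj.
  by rewrite /b Hj.
have th k : t k * rnorm (h k) = Num.sqrt (rnorm (h k)).
  have q0 : Num.sqrt (rnorm (h k)) != 0 by rewrite gt_eqF ?sqrtr_gt0.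
  by apply: (mulfI q0); rewrite mulVKf// -expr2 sqr_sqrtr// ltW.
have b1 k : rnorm (fdot (index_iota (N k) (N k.+1)) (b k) (b k)) <= 1.
  rewrite dotb -star_fdot dotb starZr star_fdot rnormZ rnormZ -/(h k).
  rewrite gtr0_norm// th mulVf// gt_eqF// sqrtr_gt0//.
have /choice[phi hphi] k : exists phi : {scalar A},
    is_state phi /\ phi (h k) = (rnorm (h k))%:C.
  have [phi] := norming_state (ispos_fdot (index_iota (N k) (N k.+1)) (x k)).
  by exists phi.
have badm : admissible b by apply: (@block_admissible N b) => //.
apply: (@le_trans _ _ (hausdorff_mnc (seminorm b phi) E)); last first.
  by apply: ereal_sup_ubound; exists b, phi; split=> // k; case: (hphi k).
apply: le_ereal_inf_tmp => _ [e [e0 [m [y [hy Ey]]]] <-].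
rewrite lee_fin leNgt; apply/negP => er.
have re0 : 0 < r - e by rewrite subr_gt0.
have /fin_all_exists[Kf hK] (j : 'I_m) := block_cvg0 Nlt b0 b1 (hy j) re0.
(* Beyond this index every center is almost orthogonal to the block vectors. *)
pose k := (\max_j Kf j)%N.
have [j _ [hx]] := Ey _ (Ex k).
rewrite ltNge => /negP; apply.
apply: le_trans (seminorm_ge b phi (x k - y j) k).
have hbk : HA (b k) by case: badm.
have [phis phih] := hphi k.
rewrite lee_fin hdotBl// (hdot_blockr Nlt b0 k hx) dotb -/(h k).
have yk : rnorm (hdot (y j) (b k)) < r - e by rewrite hK// leq_bigmax.
have xk : r < rnorm (phi k ((t k)%:C *: h k)).
  have -> : phi k ((t k)%:C *: h k) = (Num.sqrt (rnorm (h k)))%:C.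
    by rewrite linearZ /= phih -th rmorphM.
  have rh : r < Num.sqrt (rnorm (h k)).
    by rewrite -[ltLHS]gtr0_norm// -sqrtr_sqr ltr_sqrt.
  apply: (lt_le_trans rh); move: (Num.sqrt _) => c.
  by rewrite /rnorm normc_def /= expr0n addr0 sqrtr_sqr ler_norm.
have := rnorm_state (hdot (y j) (b k)) phis.
rewrite raddfB /=; set p := phi k _ in xk *; set q := phi k _.
by have := rnormD (p - q) q; rewrite subrK; lra.
Qed.

Lemma lambda_le_chi_star E : hbounded E -> (lambda_mnc E <= chi_star E)%E.
Proof.
move=> [EHA _]; have chi0 := chi_star_ge0 E.
case Echi : (chi_star E) chi0 => [c| |]; rewrite ?leey// lee_fin => c0.
apply/lee_addgt0Pr => e e0; rewrite -EFinD leNgt; apply/negP => ce.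
have := chi_star_ge EHA (_ : 0 < c + e) ce; rewrite Echi lee_fin.
by rewrite ltr_wpDl// => /(_ isT); lra.
Qed.

End LowerBound.

Theorem theorem3p5 (R : realType) (A : cstarAlgType R) (E : set (nat -> A))
  (hE : hbounded E) : chi_star E = lambda_mnc E.
Proof.
apply/eqP; rewrite eq_le chi_star_le_lambda//=; exact: lambda_le_chi_star.
Qed.
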